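(* Let $\mathcal{C}$ be a category and let $F_{\mathsf{Tr}}(\mathcal{C})$ be the structure described in the context. Then $F_{\mathsf{Tr}}(\mathcal{C})$ is a (strict) traced symmetric monoidal category, and it is the free one on the category $\mathcal{C}$: with $\iota:\mathcal{C}\to F_{\mathsf{Tr}}(\mathcal{C})$ the functor sending an object $A$ to the one-element list $(1,A)$ and a morphism $f$ to $(\varnothing,\mathrm{id}_{[1]},f)$, for every traced strict symmetric monoidal category $\mathcal{D}$ and every functor $F:\mathcal{C}\to\mathcal{D}$ there is a unique strict symmetric monoidal functor $\widehat{F}:F_{\mathsf{Tr}}(\mathcal{C})\to\mathcal{D}$ preserving traces such that $\widehat{F}\circ\iota=F$. (That is, $F_{\mathsf{Tr}}$ gives a left adjoint to the forgetful functor from traced strict symmetric monoidal categories to categories.)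
   Context: All monoidal categories are strict. A trace on a strict symmetric monoidal category $(\mathcal{D},\otimes,\mathrm{I},\tau)$ is a family of functions $\mathsf{Tr}^U_{A,B}:\mathcal{D}(A\otimes U,B\otimes U)\to\mathcal{D}(A,B)$ satisfying: Input Naturality $\mathsf{Tr}^U_{A,B}(f)\circ g=\mathsf{Tr}^U_{A',B}(f\circ(g\otimes 1_U))$; Output Naturality $g\circ\mathsf{Tr}^U_{A,B}(f)=\mathsf{Tr}^U_{A,B'}((g\otimes 1_U)\circ f)$; Feedback Dinaturality $\mathsf{Tr}^U_{A,B}((1_B\otimes g)\circ f)=\mathsf{Tr}^{U'}_{A,B}(f\circ(1_A\otimes g))$ for $f:A\otimes U\to B\otimes U'$, $g:U'\to U$; Vanishing $\mathsf{Tr}^{\mathrm{I}}_{A,B}(f)=f$ and $\mathsf{Tr}^{U\otimes V}_{A,B}(g)=\mathsf{Tr}^U_{A,B}(\mathsf{Tr}^V_{A\otimes U,B\otimes U}(g))$; Superposing $g\otimes\mathsf{Tr}^U_{A,B}(f)=\mathsf{Tr}^U_{W\otimes A,Z\otimes B}(g\otimes f)$ for $g:W\to Z$; Yanking $\mathsf{Tr}^U_{U,U}(\tau_{U,U})=1_U$. A functor $G$ preserves traces if $G(\mathsf{Tr}^U_{A,B}(f))=\mathsf{Tr}^{GU}_{GA,GB}(Gf)$. Notation: $[n]=\{1,\dots,n\}$; $S(n)$ is the symmetric group on $[n]$; for $\pi\in S(n),\sigma\in S(m)$, $\pi\otimes\sigma\in S(n+m)$ is $\pi$ on $[n]$ and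 $i\mapsto\sigma(i-n)+n$ on $\{n+1,\dots,n+m\}$; $[\lambda,\mu]$ denotes concatenation of finite sequences; $\mathcal{M}(X)$ is the free commutative monoid (finite multisets) on $X$, with multiset union $\uplus$. Loops: $\mathcal{L}[\mathcal{C}]$ is the set of endomorphisms of $\mathcal{C}$ modulo the equivalence relation generated by identifying each composite $f_k\circ\cdots\circ f_1$ (with $f_i:A_i\to A_{i+1}$, $A_{k+1}=A_1$) with all its cyclic permutations; the class of $f$ is $[f]_\sim$. For $\pi\in S(n+m)$ and $i\in[n]$, let $k\ge 0$ be least with $\pi^{k+1}(i)\le n$, and put $p_\pi(i)=\pi^{k+1}(i)$; then $p_\pi\in S(n)$. Let $\mathcal{L}(\pi)$ be the set of cycles of $\pi$ contained entirely in $\{n+1,\dots,n+m\}$. The structure $F_{\mathsf{Tr}}(\mathcal{C})$: objects are pairs $(n,A)$ with $n\in\mathbb{N}$ and $A:[n]\to\mathrm{Ob}\,\mathcal{C}$ (finite lists of objects); tensor of objects is concatenation and the unit $\mathrm{I}$ is the empty list. Morphisms $(n,A)\to(m,B)$ exist only if $n=m$, and are triples $(S,\pi,\lambda)$ with $S\in\mathcal{M}(\mathcal{L}[\mathcal{C}])$, $\pi\in S(n)$, and $\lambda_i:A_i\to B_{\pi(i)}$ a morphism of $\mathcal{C}$ for each $i\in[n]$. The identity is $(\varnothing,\mathrm{id},i\mapsto 1_{A_i})$; the symmetry $\tau$ is given by the empty multiset, the block-swap permutation and identity labels. Composition: $(T,\sigma,\mu)\circ(S,\pi,\lambda)=(S\uplus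 T,\ \sigma\circ\pi,\ i\mapsto\mu_{\pi(i)}\circ\lambda_i)$. Tensor: $(S,\pi,\lambda)\otimes(T,\sigma,\mu)=(S\uplus T,\ \pi\otimes\sigma,\ [\lambda,\mu])$. Trace: for $(S,\pi,\lambda):(n,A)\otimes(m,U)\to(n,B)\otimes(m,U)$, the trace over $(m,U)$ is $(S\uplus T,\ p_\pi,\ \mu)$, where $T$ is the multiset containing, for each cycle $j,\pi(j),\dots,\pi^{l+1}(j)=j$ in $\mathcal{L}(\pi)$ (with $l+1$ its length), one copy of $[\lambda_{\pi^l(j)}\circ\cdots\circ\lambda_{\pi(j)}\circ\lambda_j]_\sim$, and $\mu_i=\lambda_{\pi^k(i)}\circ\cdots\circ\lambda_{\pi(i)}\circ\lambda_i$ with $k$ as in the definition of $p_\pi(i)$. *)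

(* Defs.v *)
From mathcomp Require Import all_boot.
From mathcomp Require Import generic_quotient finmap multiset boolp.
From Stdlib Require Import Relations.Relation_Operators.

Set Implicit Arguments.
Unset Strict Implicit.
Unset Printing Implicit Defensive.

Declare Scope cat_scope.
Delimit Scope cat_scope with cat.
Local Open Scope cat_scope.

(* Operations are bundled in [_data] records and the axioms are predicates on
   these, so equality of functors (in [functor_data]) is equality of their
   actions on objects and morphisms. *)

Record cat_data := CatData {
  Ob :> Type;
  Hom : Ob -> Ob -> Type;
  idm : forall A, Hom A A;
  compm : forall A B C, Hom B C -> Hom A B -> Hom A C }.

Arguments Hom {c} A B.
Arguments idm {c} A.
Arguments compm {c A B C} g f.
Notation "g ∘ f" := (compm g f) (at level 40, left associativity) : cat_scope.

Record is_category (C : cat_data) : Prop := IsCategory {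
  comp_idl : forall (A B : C) (f : Hom A B), idm B ∘ f = f;
  comp_idr : forall (A B : C) (f : Hom A B), f ∘ idm A = f;
  comp_assoc : forall (A B D E : C) (f : Hom A B) (g : Hom B D) (h : Hom D E),
    h ∘ (g ∘ f) = (h ∘ g) ∘ f }.

Record category := Category {
  category_data :> cat_data;
  category_axioms : is_category category_data }.

(* Transport of a morphism along equalities of objects; by proof irrelevance
   it does not depend on the equality proofs. *)
Definition castm (C : cat_data) (A A' B B' : C) (eA : A = A') (eB : B = B')
    (f : Hom A B) : Hom A' B' :=
  match eA in _ = X, eB in _ = Y return Hom X Y with
  | erefl, erefl => f
  end.

Record functor_data (C D : cat_data) := FunctorData {
  fobj :> C -> D;
  fmap : forall A B : C, Hom A B -> Hom (fobj A) (fobj B) }.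

Arguments fmap {C D} f {A B} _.

Record is_functor (C D : cat_data) (F : functor_data C D) : Prop := IsFunctor {
  fmap_id : forall A, fmap F (idm A) = idm (F A);
  fmap_comp : forall (A B E : C) (f : Hom A B) (g : Hom B E),
    fmap F (g ∘ f) = fmap F g ∘ fmap F f }.

Definition functor_comp (C D E : cat_data) (G : functor_data D E)
    (F : functor_data C D) : functor_data C E :=
  FunctorData (fun A B f => fmap G (@fmap C D F A B f)).

Record tsmc_data := TsmcData {
  tsmc_cat :> cat_data;
  tens : tsmc_cat -> tsmc_cat -> tsmc_cat;
  unit_ob : tsmc_cat;
  tensm : forall A A' B B', Hom A A' -> Hom B B' -> Hom (tens A B) (tens A' B');
  sym : forall A B, Hom (tens A B) (tens B A);
  tr : forall U A B, Hom (tens A U) (tens B U) -> Hom A B }.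

Arguments tens {t} A B.
Arguments unit_ob {t}.
Arguments tensm {t A A' B B'} f g.
Arguments sym {t} A B.
Arguments tr {t} U {A B} f.
Notation "A ⊗ B" := (tens A B) (at level 38, left associativity) : cat_scope.
Notation "f ⊗m g" := (tensm f g) (at level 38, left associativity) : cat_scope.

Record is_strict_monoidal (D : tsmc_data) : Prop := IsStrictMonoidal {
  tensA : forall A B C : D, A ⊗ (B ⊗ C) = (A ⊗ B) ⊗ C;
  tensIl : forall A : D, unit_ob ⊗ A = A;
  tensIr : forall A : D, A ⊗ unit_ob = A;
  tensm_id : forall A B : D, idm A ⊗m idm B = idm (A ⊗ B);
  tensm_comp : forall (A B C A' B' C' : D) (f : Hom A B) (g : Hom B C)
      (f' : Hom A' B') (g' : Hom B' C'),
    (g ∘ f) ⊗m (g' ∘ f') = (g ⊗m g') ∘ (f ⊗m f');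
  tensmA : forall (A B C A' B' C' : D)
      (f : Hom A A') (g : Hom B B') (h : Hom C C'),
    castm (tensA A B C) (tensA A' B' C') (f ⊗m (g ⊗m h)) = (f ⊗m g) ⊗m h;
  tensmIl : forall (A B : D) (f : Hom A B),
    castm (tensIl A) (tensIl B) (idm unit_ob ⊗m f) = f;
  tensmIr : forall (A B : D) (f : Hom A B),
    castm (tensIr A) (tensIr B) (f ⊗m idm unit_ob) = f }.

Record is_symmetric (D : tsmc_data) (M : is_strict_monoidal D) : Prop :=
IsSymmetric {
  sym_nat : forall (A A' B B' : D) (f : Hom A A') (g : Hom B B'),
    sym A' B' ∘ (f ⊗m g) = (g ⊗m f) ∘ sym A B;
  symK : forall A B : D, sym B A ∘ sym A B = idm (A ⊗ B);
  sym_hexagon : forall A B C : D,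
    castm (tensA M A B C) (esym (tensA M B C A)) (sym A (B ⊗ C)) =
    (idm B ⊗m sym A C) ∘ castm erefl (esym (tensA M B A C)) (sym A B ⊗m idm C);
  sym_unit : forall A : D,
    castm (tensIr M A) (tensIl M A) (sym A unit_ob) = idm A }.

Record is_trace (D : tsmc_data) (M : is_strict_monoidal D) : Prop := IsTrace {
  tr_input : forall (U A A' B : D) (f : Hom (A ⊗ U) (B ⊗ U)) (g : Hom A' A),
    tr U f ∘ g = tr U (f ∘ (g ⊗m idm U));
  tr_output : forall (U A B B' : D) (f : Hom (A ⊗ U) (B ⊗ U)) (g : Hom B B'),
    g ∘ tr U f = tr U ((g ⊗m idm U) ∘ f);
  tr_dinat : forall (U U' A B : D) (f : Hom (A ⊗ U) (B ⊗ U')) (g : Hom U' U),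
    tr U ((idm B ⊗m g) ∘ f) = tr U' (f ∘ (idm A ⊗m g));
  tr_vanish_unit : forall (A B : D) (f : Hom (A ⊗ unit_ob) (B ⊗ unit_ob)),
    tr unit_ob f = castm (tensIr M A) (tensIr M B) f;
  tr_vanish_tens : forall (U V A B : D)
      (g : Hom (A ⊗ (U ⊗ V)) (B ⊗ (U ⊗ V))),
    tr (U ⊗ V) g = tr U (tr V (castm (tensA M A U V) (tensA M B U V) g));
  tr_superpose : forall (U A B W Z : D) (f : Hom (A ⊗ U) (B ⊗ U)) (g : Hom W Z),
    g ⊗m tr U f = tr U (castm (tensA M W A U) (tensA M Z B U) (g ⊗m f));
  tr_yank : forall U : D, tr U (sym U U) = idm U }.

Record is_traced_ssmc (D : tsmc_data) : Prop := IsTracedSsmc {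
  ssmc_category : is_category D;
  ssmc_monoidal : is_strict_monoidal D;
  ssmc_symmetric : is_symmetric ssmc_monoidal;
  ssmc_trace : is_trace ssmc_monoidal }.

Record traced_ssmc := TracedSsmc {
  traced_ssmc_data :> tsmc_data;
  traced_ssmc_axioms : is_traced_ssmc traced_ssmc_data }.

Record is_traced_ssm_functor (D E : tsmc_data) (G : functor_data D E) : Prop :=
IsTracedSsmFunctor {
  tfun_functor : is_functor G;
  tfun_tens : forall A B : D, G (A ⊗ B) = G A ⊗ G B;
  tfun_unit : G unit_ob = unit_ob;
  tfun_tensm : forall (A A' B B' : D) (f : Hom A A') (g : Hom B B'),
    castm (tfun_tens A B) (tfun_tens A' B') (fmap G (f ⊗m g)) =
    fmap G f ⊗m fmap G g;
  tfun_sym : forall A B : D,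
    castm (tfun_tens A B) (tfun_tens B A) (fmap G (sym A B)) = sym (G A) (G B);
  tfun_tr : forall (U A B : D) (f : Hom (A ⊗ U) (B ⊗ U)),
    fmap G (tr U f) = tr (G U) (castm (tfun_tens A U) (tfun_tens B U) (fmap G f)) }.

Section Loops.
Variable C : cat_data.

Inductive chain : C -> C -> Type :=
| chain_nil A : chain A A
| chain_cons A B D : Hom A B -> chain B D -> chain A D.

Fixpoint chain_comp A B (p : chain A B) : Hom A B :=
  match p in chain A B return Hom A B with
  | chain_nil A => idm A
  | chain_cons _ _ _ f q => chain_comp q ∘ f
  end.

Fixpoint chain_cat A B (p : chain A B) E : chain B E -> chain A E :=
  match p in chain A B return chain B E -> chain A E with
  | chain_nil _ => fun r => r
  | chain_cons _ _ _ f q => fun r => chain_cons f (chain_cat q r)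
  end.

Definition endo := {A : C & Hom A A}.
Definition Endo (A : C) (f : Hom A A) : endo := existT (fun A => Hom A A) A f.

(* [p; q] and [q; p] range over the closed chains and their rotations. *)
Inductive cyclic_perm : endo -> endo -> Prop :=
| CyclicPerm A B (p : chain A B) (q : chain B A) :
    cyclic_perm (Endo (chain_comp (chain_cat p q)))
                (Endo (chain_comp (chain_cat q p))).

Definition loop_rel : rel {classic endo} :=
  fun f g => `[< clos_refl_sym_trans endo cyclic_perm f g >].

Lemma loop_rel_refl : reflexive loop_rel.
Proof. by move=> f; apply/asboolP; apply: rst_refl. Qed.

Lemma loop_rel_sym : symmetric loop_rel.
Proof. by move=> f g; apply/asboolP/asboolP => ?; apply: rst_sym. Qed.

Lemma loop_rel_trans : transitive loop_rel.
Proof.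
move=> g f h /asboolP fg /asboolP gh; apply/asboolP.
exact: rst_trans fg gh.
Qed.

Canonical loop_equiv := EquivRel loop_rel loop_rel_refl loop_rel_sym loop_rel_trans.

Definition loops : choiceType := {eq_quot loop_equiv}%qT.

Definition loop_class (A : C) (f : Hom A A) : loops :=
  (\pi_({eq_quot loop_equiv}) (Endo f : {classic endo}))%qT.

End Loops.

Record flist (T : Type) := FList { arity : nat; entry :> 'I_arity -> T }.
Arguments FList {T arity} entry.

Definition sum_entry T n m (A : 'I_n -> T) (B : 'I_m -> T) (s : 'I_n + 'I_m) : T :=
  match s with inl i => A i | inr j => B j end.

Definition flist_cat T (X Y : flist T) : flist T :=
  FList (fun i : 'I_(arity X + arity Y) => sum_entry X Y (split i)).

Definition flist_nil T : flist T :=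
  FList (fun i : 'I_0 => False_rect T (notF (ltn_ord i))).

Definition flist1 T (x : T) : flist T := FList (fun _ : 'I_1 => x).

Definition sum_map n m n' m' (p : 'I_n -> 'I_n') (q : 'I_m -> 'I_m')
    (s : 'I_n + 'I_m) : 'I_n' + 'I_m' :=
  match s with inl i => inl (p i) | inr j => inr (q j) end.

Definition sum_swap n m (s : 'I_n + 'I_m) : 'I_m + 'I_n :=
  match s with inl i => inr i | inr j => inl j end.

Lemma split_bij n m : bijective (@split n m).
Proof. by exists (@unsplit n m); [exact: splitK | exact: unsplitK]. Qed.

Lemma unsplit_bij n m : bijective (@unsplit n m).
Proof. by exists (@split n m); [exact: unsplitK | exact: splitK]. Qed.

Lemma sum_map_bij n m n' m' (p : 'I_n -> 'I_n') (q : 'I_m -> 'I_m') :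
  bijective p -> bijective q -> bijective (sum_map p q).
Proof.
case=> p' pK p'K [q' qK q'K]; exists (sum_map p' q') => -[i|j] /=;
  by rewrite ?pK ?qK ?p'K ?q'K.
Qed.

Lemma sum_swap_bij n m : bijective (@sum_swap n m).
Proof. by exists (@sum_swap m n); case. Qed.

Section FTr.
Variable C : cat_data.

Local Open Scope mset_scope.

(* The arities of X and Y are only propositionally equal, so that the
   permutation of [n] is rendered as a bijection from [arity X] to
   [arity Y]. *)
Record fhom (X Y : flist C) := FHom {
  fhom_arity : arity X = arity Y;
  floops : {mset loops C};
  fperm : 'I_(arity X) -> 'I_(arity Y);
  fperm_bij : bijective fperm;
  flabel : forall i, Hom (X i) (Y (fperm i)) }.

Definition fid (X : flist C) : fhom X X :=
  FHom erefl mset0 (Bijective (frefl id) (frefl id)) (fun i => idm (X i)).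

Definition fcomp (X Y Z : flist C) (g : fhom Y Z) (f : fhom X Y) : fhom X Z :=
  FHom (etrans (fhom_arity f) (fhom_arity g)) (floops f `+` floops g)
    (bij_comp (fperm_bij g) (fperm_bij f))
    (fun i => flabel g (fperm f i) ∘ flabel f i).

Definition ftens_perm X X' Y Y' (f : fhom X X') (g : fhom Y Y')
    (i : 'I_(arity X + arity Y)) : 'I_(arity X' + arity Y') :=
  unsplit (sum_map (fperm f) (fperm g) (split i)).

Lemma ftens_perm_bij X X' Y Y' (f : fhom X X') (g : fhom Y Y') :
  bijective (ftens_perm f g).
Proof.
apply: bij_comp; first exact: unsplit_bij.
apply: bij_comp; last exact: split_bij.
exact: sum_map_bij (fperm_bij f) (fperm_bij g).
Qed.

Definition ftens_label X X' Y Y' (f : fhom X X') (g : fhom Y Y')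
    (s : 'I_(arity X) + 'I_(arity Y)) :
    Hom (sum_entry X Y s) (sum_entry X' Y' (sum_map (fperm f) (fperm g) s)) :=
  match s with inl i => flabel f i | inr j => flabel g j end.

Definition ftens X X' Y Y' (f : fhom X X') (g : fhom Y Y') :
    fhom (flist_cat X Y) (flist_cat X' Y') :=
  @FHom (flist_cat X Y) (flist_cat X' Y')
    (congr2 addn (fhom_arity f) (fhom_arity g))
    (floops f `+` floops g) (ftens_perm f g) (ftens_perm_bij f g)
    (fun i => castm erefl (congr1 (sum_entry X' Y') (esym (unsplitK _)))
                (ftens_label f g (split i))).

Definition fsym_perm n m (i : 'I_(n + m)) : 'I_(m + n) :=
  unsplit (sum_swap (split i)).

Lemma fsym_perm_bij n m : bijective (@fsym_perm n m).
Proof.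
apply: bij_comp; first exact: unsplit_bij.
exact: bij_comp (@sum_swap_bij _ _) (@split_bij _ _).
Qed.

Lemma fsym_entry (X Y : flist C) (i : 'I_(arity X + arity Y)) :
  flist_cat X Y i = flist_cat Y X (fsym_perm i).
Proof. by rewrite /= unsplitK; case: (split i). Qed.

Definition fsym X Y : fhom (flist_cat X Y) (flist_cat Y X) :=
  @FHom (flist_cat X Y) (flist_cat Y X) (addnC _ _) mset0
    _ (@fsym_perm_bij (arity X) (arity Y))
    (fun i => castm erefl (fsym_entry i) (idm (flist_cat X Y i))).

(* [fperm f], with [arity Y] identified with [arity X] so that it can be
   iterated. *)
Definition fendo X Y (f : fhom X Y) (i : 'I_(arity X)) : 'I_(arity X) :=
  cast_ord (esym (fhom_arity f)) (fperm f i).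

Lemma fendo_inj X Y (f : fhom X Y) : injective (fendo f).
Proof. by move=> i j /cast_ord_inj; apply: (bij_inj (fperm_bij f)). Qed.

Section Trace.
Variables U A B : flist C.
Variable f : fhom (flist_cat A U) (flist_cat B U).

Local Notation n := (arity A).
Local Notation m := (arity U).
Local Notation AU := (flist_cat A U).
Local Notation BU := (flist_cat B U).
Local Notation "π^ k" := (iter k (fendo f)) (at level 1, k at level 1).

Lemma ftr_arity : arity A = arity B.
Proof. exact: (addIn (fhom_arity f)). Qed.

Lemma fexit_ex (i : 'I_n) : exists k, (π^(k.+1) (lshift m i) < n)%N.
Proof.
exists (order (fendo f) (lshift m i)).-1.
by rewrite (ltn_predK (order_gt0 _ _)) (iter_order (@fendo_inj _ _ f)) /=.
Qed.

Definition fexit_time (i : 'I_n) : nat := ex_minn (fexit_ex i).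

Lemma fexit_lt (i : 'I_n) :
  (fperm f (π^(fexit_time i) (lshift m i)) < arity B)%N.
Proof. by rewrite -ftr_arity /fexit_time; case: ex_minnP. Qed.

Definition ftr_perm (i : 'I_n) : 'I_(arity B) := Ordinal (fexit_lt i).

Lemma fexit_ge (i : 'I_n) (l : nat) :
  (0 < l <= fexit_time i)%N -> (n <= π^l (lshift m i))%N.
Proof.
rewrite /fexit_time; case: ex_minnP => k _ kmin; case: l => // l /= lk.
by rewrite leqNgt; apply/negP => /kmin; rewrite leqNgt lk.
Qed.

Lemma ftr_perm_bij : bijective ftr_perm.
Proof.
apply: inj_card_bij; last by rewrite !card_ord ftr_arity.
have inj_iter k : injective (π^k).
  by elim: k => [|k IHk] // x y /= /(@fendo_inj _ _ f) /IHk.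
suff main (i j : 'I_n) : (fexit_time i <= fexit_time j)%N ->
    ftr_perm i = ftr_perm j -> i = j.
  move=> i j eij; have [le_ij|/ltnW le_ji] := leqP (fexit_time i) (fexit_time j).
    exact: main le_ij eij.
  exact: esym (main _ _ le_ji (esym eij)).
move=> le_ij /(congr1 val) /= /val_inj /(bij_inj (fperm_bij f)).
rewrite -(subnKC le_ij) iterD => /inj_iter.
case def_l: (fexit_time j - fexit_time i)%N => [|l]; first by move/lshift_inj.
move=> /(congr1 val) /= eq_i.
have := @fexit_ge j l.+1; rewrite /= -eq_i -def_l leq_subr => /(_ isT).
by rewrite leqNgt ltn_ord.
Qed.

Lemma feedback_entry (j : 'I_(n + m)) :
  (n <= fendo f j)%N -> BU (fperm f j) = AU (fendo f j).
Proof.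
have val_j : val (fperm f j) = val (fendo f j) by [].
move: (fperm f j) (fendo f j) val_j => y z val_yz ge_z /=.
case: (splitP z) => a val_a.
  by move: ge_z; rewrite val_a leqNgt ltn_ord.
case: (splitP y) => b val_b.
  by move: ge_z; rewrite -val_yz /= val_b ftr_arity leqNgt ltn_ord.
congr (U _); apply/val_inj/(@addnI n).
by rewrite /= -val_a -val_yz /= val_b ftr_arity.
Qed.

(* λ_{π^k j} ∘ ... ∘ λ_{π j} ∘ λ_j, when π j, ..., π^k j all lie in the
   feedback part U *)
Fixpoint fwalk (k : nat) (j : 'I_(n + m)) :
    (forall l, (0 < l <= k)%N -> (n <= π^l j)%N) ->
    Hom (AU j) (BU (fperm f (π^k j))) :=
  match k with
  | 0 => fun _ => flabel f j
  | k'.+1 => fun h =>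
      flabel f (π^(k'.+1) j) ∘
      castm erefl (feedback_entry (h k'.+1 (leqnn k'.+1)))
        (@fwalk k' j (fun l hl => h l (introT andP
           (conj (proj1 (andP hl)) (leqW (proj2 (andP hl)))))))
  end.

Lemma ftr_src (i : 'I_n) : AU (lshift m i) = A i.
Proof. by rewrite /= (unsplitK (inl i)). Qed.

Lemma ftr_tgt (i : 'I_n) :
  BU (fperm f (π^(fexit_time i) (lshift m i))) = B (ftr_perm i).
Proof.
rewrite -[fperm f _](_ : lshift m (ftr_perm i) = _) /=; last exact: val_inj.
by rewrite (unsplitK (inl _)).
Qed.

Definition ftr_label (i : 'I_n) : Hom (A i) (B (ftr_perm i)) :=
  castm (ftr_src i) (ftr_tgt i) (fwalk (@fexit_ge i)).

Definition in_feedback (j : 'I_(n + m)) : Prop := forall l, (n <= π^l j)%N.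

Lemma floop_tgt (j : 'I_(n + m)) : in_feedback j ->
  BU (fperm f (π^((order (fendo f) j).-1) j)) = AU j.
Proof.
have iterK : fendo f (π^((order (fendo f) j).-1) j) = j.
  by rewrite -iterS (ltn_predK (order_gt0 _ _)) (iter_order (@fendo_inj _ _ f)).
move=> fb_j; rewrite feedback_entry ?iterK //; exact: (fb_j 0).
Qed.

(* [order (fendo f) j] is the length of the cycle of j *)
Definition floop (j : 'I_(n + m)) (h : in_feedback j) : Hom (AU j) (AU j) :=
  castm erefl (floop_tgt h)
    (@fwalk (order (fendo f) j).-1 j (fun l _ => h l)).

(* One summand for each cycle contained in the feedback part: [froots] selects
   one element j of each cycle of π, and the class of [floop j] does not depend
   on which element is selected. *)
Definition ftr_loops : {mset loops C} :=
  \big[@msetD (loops C)/mset0]_(j | froots (fendo f) j)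
    match pselect (in_feedback j) with
    | left h => [mset loop_class (floop h)]
    | right _ => mset0
    end.

Definition ftr : fhom A B :=
  FHom ftr_arity (floops f `+` ftr_loops) ftr_perm_bij ftr_label.

End Trace.

Definition FTr : tsmc_data :=
  @TsmcData (@CatData (flist C) fhom fid fcomp)
    (@flist_cat C) (@flist_nil C) ftens fsym ftr.

Definition iota : functor_data C FTr :=
  @FunctorData C FTr (@flist1 C) (fun A B h =>
    @FHom (flist1 A) (flist1 B) erefl mset0 id
      (Bijective (frefl id) (frefl id)) (fun _ => h)).

End FTr.

(* Main.v *)
From HB Require Import structures.
From mathcomp Require Import all_boot zify.
From mathcomp Require Import generic_quotient finmap multiset boolp.
From Stdlib Require Import Relations.Relation_Operators.
Require Import Defs.

(** A morphism f of the free category is handled as a permutation of the natural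
    numbers together with arrow-valued labels, so that the trace follows trails of
    f through the feedback part. All trace axioms but dinaturality compare trails of
    two systems that agree on the feedback part or of which one is a first-return
    map of the other; dinaturality compares the cycles of two conjugate maps.

    For the universal property, every morphism is a multiset of loops tensored with
    a labelled permutation, and the latter is built by adding one wire at a time:
    a : X -> P (x) Q and l : x -> y give (1_P (x) sym_{Q,y}) o (a (x) l). These
    normal forms are closed under composition, tensor, symmetry and trace by
    computations valid in any traced symmetric monoidal category. Performing them
    simultaneously in the free category and in D yields a relation compatible with
    the whole structure; it is total and functional because a normal form can be
    read off from the permutation and the labels. *)

(** Defining the extension directly on a triple would mean factoring its permutation into
    symmetries, proving independence of the factorization from a presentation of the symmetric
    groups, and then matching the cycle formula for the trace with the trace of the target. The
    relation avoids this: its closure properties follow from the axioms alone, in both categories at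
    once, and no permutation is computed in them. The explicit formula for the trace serves only to
    establish the axioms and to evaluate the trace of a single wire. The trace over a list is
    reduced by vanishing to one wire, which is either closed on itself, giving a scalar, or
    straightened by yanking.

    The other obstacle is strictness, an equality of objects that would put a transport into nearly
    every equation; hence arrows carry their endpoints as data, and typing becomes a separate side
    condition. *)

Set Implicit Arguments.
Unset Strict Implicit.
Unset Printing Implicit Defensive.

Local Open Scope cat_scope.
Local Open Scope mset_scope.

(** * Arrows with their endpoints bundled *)

Arguments castm : simpl never.

Section Arrows.
Variable C : cat_data.

(* [castm] is invisible on [arr] (lemma [Arr_castm]), so that the laws of a
   strict monoidal category become plain equations between arrows. *)
Record arr := Arr { adom : C; acod : C; mor : Hom adom acod }.

Lemma arr_eq (A B A' B' : C) (f : Hom A B) (g : Hom A' B') :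
  Arr f = Arr g -> exists (eA : A = A') (eB : B = B'), castm eA eB f = g.
Proof.
have aux (a b : arr) : a = b -> exists (eA : adom a = adom b) (eB : acod a = acod b),
    castm eA eB (mor a) = mor b by move=> ->; exists erefl, erefl.
exact: (aux (Arr f) (Arr g)).
Qed.

Lemma castm_id (A B : C) (eA : A = A) (eB : B = B) (f : Hom A B) :
  castm eA eB f = f.
Proof. by rewrite (Prop_irrelevance eA erefl) (Prop_irrelevance eB erefl). Qed.

Lemma arr_inj (A B : C) (f g : Hom A B) : Arr f = Arr g -> f = g.
Proof. by case/arr_eq => eA [eB]; rewrite castm_id. Qed.

Lemma Arr_castm (A A' B B' : C) (eA : A = A') (eB : B = B') (f : Hom A B) :
  Arr (castm eA eB f) = Arr f.
Proof. by case: A' / eA; case: B' / eB. Qed.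

(* [None] marks non-composable pairs; since it is absorbing, composition is
   associative without side conditions. *)
Definition ocomp (g f : option arr) : option arr :=
  match g, f with
  | Some g, Some f =>
      match pselect (acod f = adom g) with
      | left e => Some (Arr (mor g ∘ castm erefl e (mor f)))
      | right _ => None
      end
  | _, _ => None
  end.

Arguments ocomp : simpl never.

Lemma ocompE (A B D : C) (g : Hom B D) (f : Hom A B) :
  ocomp (Some (Arr g)) (Some (Arr f)) = Some (Arr (g ∘ f)).
Proof. by rewrite /ocomp /=; case: pselect => //= e; rewrite castm_id. Qed.

Lemma ocompN (a b : arr) : acod b <> adom a -> ocomp (Some a) (Some b) = None.
Proof. by rewrite /ocomp; case: pselect. Qed.

Lemma ocomp0r g : ocomp g None = None. Proof. by case: g. Qed.

Lemma ocomp_typed (A B B' D : C) (g : Hom B D) (f : Hom A B') (e : B' = B) :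
  ocomp (Some (Arr g)) (Some (Arr f)) = Some (Arr (g ∘ castm erefl e f)).
Proof. by case: B / e g => g; rewrite ocompE. Qed.

Definition oid (A : C) := Some (Arr (idm A)).

Hypothesis H : is_category C.

Lemma ocompA h g f : ocomp h (ocomp g f) = ocomp (ocomp h g) f.
Proof.
case: h => [[A B h]|] //; case: g => [[A' B' g]|] //; case: f => [[A'' B'' f]|];
  last by rewrite !ocomp0r.
case: (pselect (B' = A)) => [e|ne].
  case: A / e h => h; rewrite ocompE.
  case: (pselect (B'' = A')) => [e|ne].
    by case: A' / e g => g; rewrite !ocompE (comp_assoc H).
  by rewrite !(@ocompN _ (Arr f)).
rewrite (@ocompN (Arr h)) //; case: (pselect (B'' = A')) => [e|ne'].
  by case: A' / e g => g; rewrite ocompE ocompN.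
by rewrite (@ocompN _ (Arr f)).
Qed.

Definition oadom (f : option arr) := omap adom f.
Definition oacod (f : option arr) := omap acod f.

Lemma ocomp_idl A f : oacod f = Some A -> ocomp (oid A) f = f.
Proof. by case: f => [[X Y f]|] //= [<-]; rewrite /oid ocompE (comp_idl H). Qed.

Lemma ocomp_idr A f : oadom f = Some A -> ocomp f (oid A) = f.
Proof. by case: f => [[X Y f]|] //= [<-]; rewrite /oid ocompE (comp_idr H). Qed.

(* [mset0] on arrows that are not endomorphisms, which makes [oloopC] hold
   unconditionally. *)
Definition oloop (f : option arr) : {mset loops C} :=
  match f with
  | Some a =>
      match pselect (acod a = adom a) with
      | left e => [mset loop_class (castm erefl e (mor a))]
      | right _ => mset0
      end
  | None => mset0
  end.

Lemma oloopE A (f : Hom A A) : oloop (Some (Arr f)) = [mset loop_class f].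
Proof. by rewrite /oloop; case: pselect => // e; rewrite castm_id. Qed.

Lemma chain_catE (A B : C) (p : chain A B) D (q : chain B D) :
  chain_comp (chain_cat p q) = chain_comp q ∘ chain_comp p.
Proof.
elim: p D q => [X|X Y Z f p IHp] D q /=; first by rewrite (comp_idr H).
by rewrite IHp (comp_assoc H).
Qed.

Lemma loop_classP (A B : C) (f : Hom A A) (g : Hom B B) :
  loop_class f = loop_class g <->
  clos_refl_sym_trans _ (@cyclic_perm C) (Endo f) (Endo g).
Proof.
split.
  by move=> /eqmodP /asboolP.
by move=> fg; apply/eqmodP/asboolP.
Qed.

Lemma loop_classC (A B : C) (f : Hom A B) (g : Hom B A) :
  loop_class (g ∘ f) = loop_class (f ∘ g).
Proof.
apply/loop_classP/rst_step.
have := CyclicPerm (chain_cons f (chain_nil B)) (chain_cons g (chain_nil A)).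
by rewrite /= !(comp_idl H).
Qed.

Lemma oloopC f g : oloop (ocomp f g) = oloop (ocomp g f).
Proof.
case: f => [[A B f]|]; last by rewrite ocomp0r.
case: g => [[A' B' g]|] //.
case: (pselect (B = A')) => [e|ne].
  case: A' / e g => g; rewrite ocompE; case: (pselect (B' = A)) => [e|ne].
    by case: A / e f => f; rewrite ocompE !oloopE loop_classC.
  by rewrite ocompN //= ; case: pselect => // /esym.
rewrite (@ocompN (Arr g)) //; case: (pselect (B' = A)) => [e|ne'].
  by case: A / e f => f; rewrite ocompE /=; case: pselect.
by rewrite (@ocompN (Arr f)).
Qed.

End Arrows.

Arguments oid {C} A.
Arguments ocomp {C} g f : simpl never.
Arguments Arr {C adom acod} mor.

(** * Objects and morphisms of the free category seen through natural numbers *)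

Section Entries.
Variable T : Type.
Implicit Types X Y Z : flist T.

Definition entry_at X (i : nat) : option T := omap X (insub i).

Lemma entry_at_ord X (i : 'I_(arity X)) : entry_at X i = Some (X i).
Proof. by rewrite /entry_at valK. Qed.

Lemma entry_at_out X i : arity X <= i -> entry_at X i = None.
Proof. by move=> le; rewrite /entry_at insubF // ltnNge le. Qed.

Lemma flist_eq X Y : arity X = arity Y -> entry_at X =1 entry_at Y -> X = Y.
Proof.
case: X Y => n X [m Y] /= e; case: m / e Y => Y XY; congr FList.
apply: funext => i; have := XY (val i).
by rewrite (@entry_at_ord (FList X) i) (@entry_at_ord (FList Y) i) => -[].
Qed.

Lemma entry_at_cat X Y i :
  entry_at (flist_cat X Y) i =
  if i < arity X then entry_at X i else entry_at Y (i - arity X).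
Proof.
have [lt|ge] := ltnP i (arity X + arity Y); last first.
  rewrite entry_at_out // ltnNge (leq_trans (leq_addr _ _) ge) /= entry_at_out //; lia.
rewrite -[i]/(val (Ordinal lt)) (@entry_at_ord (flist_cat X Y)) /=.
by case: (splitP (Ordinal lt)) => j /= ->; rewrite ?addKn entry_at_ord.
Qed.

Lemma entry_at_nil i : entry_at (flist_nil T) i = None.
Proof. by rewrite entry_at_out. Qed.

Lemma flist_catA X Y Z :
  flist_cat X (flist_cat Y Z) = flist_cat (flist_cat X Y) Z.
Proof.
apply: flist_eq => [|i] /=; first by rewrite addnA.
rewrite !entry_at_cat /= subnDA; do !case: ifP; try lia; done.
Qed.

Lemma flist_cat0l X : flist_cat (flist_nil T) X = X.
Proof. by apply: flist_eq => // i; rewrite entry_at_cat /= subn0. Qed.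

Lemma flist_cat0r X : flist_cat X (flist_nil T) = X.
Proof.
apply: flist_eq => [|i] /=; first by rewrite addn0.
by rewrite entry_at_cat; case: ltnP => // le; rewrite entry_at_nil entry_at_out.
Qed.

End Entries.

Ltac case_ifs :=
  repeat match goal with
  | |- context [if ?b then _ else _] =>
      lazymatch b with
      | context [if _ then _ else _] => fail
      | _ => let E := fresh in case E: b
      end
  end.

Section Views.
Variable C : category.
Implicit Types X Y Z : flist C.

(* Out of range, [perm_at f] is the identity and [label_at f] is [None]. *)
Definition perm_at X Y (f : fhom X Y) (i : nat) : nat :=
  if insub i is Some j then val (fperm f j) else i.

Definition label_at X Y (f : fhom X Y) (i : nat) : option (arr C) :=
  omap (fun j => Arr (flabel f j)) (insub i).

Lemma perm_at_ord X Y (f : fhom X Y) (i : 'I_(arity X)) : perm_at f i = fperm f i.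
Proof. by rewrite /perm_at valK. Qed.

Lemma label_at_ord X Y (f : fhom X Y) (i : 'I_(arity X)) :
  label_at f i = Some (Arr (flabel f i)).
Proof. by rewrite /label_at valK. Qed.

Lemma perm_at_out X Y (f : fhom X Y) i : arity X <= i -> perm_at f i = i.
Proof. by move=> le; rewrite /perm_at insubF // ltnNge le. Qed.

Lemma label_at_out X Y (f : fhom X Y) i : arity X <= i -> label_at f i = None.
Proof. by move=> le; rewrite /label_at insubF // ltnNge le. Qed.

Lemma perm_at_lt X Y (f : fhom X Y) i : (perm_at f i < arity X) = (i < arity X).
Proof.
have [lt|ge] := ltnP i (arity X).
  by rewrite -[i]/(val (Ordinal lt)) perm_at_ord [X in _ < X](fhom_arity f) ltn_ord.
by rewrite perm_at_out // ltnNge ge.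
Qed.

Lemma perm_at_inj X Y (f : fhom X Y) : injective (perm_at f).
Proof.
move=> i j eij.
have E : (i < arity X) = (j < arity X) by rewrite -(perm_at_lt f) eij perm_at_lt.
have [lt|ge] := ltnP i (arity X); last first.
  by move: eij; rewrite !perm_at_out // leqNgt -E -leqNgt.
have ltj : j < arity X by rewrite -E.
move: eij; rewrite -[i]/(val (Ordinal lt)) -[j]/(val (Ordinal ltj)) !perm_at_ord.
by move=> /val_inj /(bij_inj (fperm_bij f)) ->.
Qed.

Lemma label_at_dom X Y (f : fhom X Y) i : oadom (label_at f i) = entry_at X i.
Proof.
have [lt|ge] := ltnP i (arity X); last by rewrite label_at_out // entry_at_out.
by rewrite -[i]/(val (Ordinal lt)) label_at_ord entry_at_ord.
Qed.

Lemma label_at_cod X Y (f : fhom X Y) i : oacod (label_at f i) = entry_at Y (perm_at f i).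
Proof.
have [lt|ge] := ltnP i (arity X).
  by rewrite -[i]/(val (Ordinal lt)) label_at_ord perm_at_ord entry_at_ord.
by rewrite label_at_out // perm_at_out // entry_at_out // -(fhom_arity f).
Qed.

(** The labels depend on the permutation, so neither can be compared pointwise in the typed form.
    The views have no such dependency, and equating bundled arrows allows endpoints that are equal
    only propositionally. *)
Lemma fhom_eq X X' Y Y' (f : fhom X Y) (g : fhom X' Y') :
  X = X' -> Y = Y' -> floops f = floops g ->
  perm_at f =1 perm_at g -> label_at f =1 label_at g ->
  @Arr (FTr C) X Y f = @Arr (FTr C) X' Y' g.
Proof.
move=> eX eY; case: X' / eX g; case: Y' / eY => g.
case: f g => e S p b l [e' S' p' b' l'] /= eS epv elb; congr Arr.
have ep : p = p'.
  apply: funext => i; apply: val_inj.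
  by have := epv i; rewrite !perm_at_ord.
case: S' / eS epv elb; case: p' / ep b' l' => b' l' _ elb.
have -> : l = l'.
  apply: functional_extensionality_dep => i.
  by have := elb i; rewrite !label_at_ord => /Some_inj /arr_inj.
by rewrite (Prop_irrelevance b b') (Prop_irrelevance e e').
Qed.

Lemma perm_at_castm X X' Y Y' (eX : X = X') (eY : Y = Y') (f : fhom X Y) :
  perm_at (@castm (FTr C) _ _ _ _ eX eY f) = perm_at f.
Proof. by case: X' / eX; case: Y' / eY. Qed.

Lemma label_at_castm X X' Y Y' (eX : X = X') (eY : Y = Y') (f : fhom X Y) :
  label_at (@castm (FTr C) _ _ _ _ eX eY f) = label_at f.
Proof. by case: X' / eX; case: Y' / eY. Qed.

Lemma floops_castm X X' Y Y' (eX : X = X') (eY : Y = Y') (f : fhom X Y) :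
  floops (@castm (FTr C) _ _ _ _ eX eY f) = floops f.
Proof. by case: X' / eX; case: Y' / eY. Qed.

Lemma perm_at_id X i : perm_at (fid X) i = i.
Proof. by rewrite /perm_at; case: insubP => //= j _. Qed.

Lemma label_at_id X i : label_at (fid X) i = omap (fun A => Arr (idm A)) (entry_at X i).
Proof. by rewrite /label_at /entry_at; case: insubP. Qed.

Lemma label_at_idE X i A : entry_at X i = Some A -> label_at (fid X) i = oid A.
Proof. by rewrite label_at_id => ->. Qed.

Lemma perm_at_comp X Y Z (g : fhom Y Z) (f : fhom X Y) i :
  perm_at (fcomp g f) i = perm_at g (perm_at f i).
Proof.
have [lt|ge] := ltnP i (arity X).
  by rewrite -[i]/(val (Ordinal lt)) !perm_at_ord.
by rewrite !(perm_at_out f) // !perm_at_out // -(fhom_arity f).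
Qed.

Lemma label_at_comp X Y Z (g : fhom Y Z) (f : fhom X Y) i :
  label_at (fcomp g f) i = ocomp (label_at g (perm_at f i)) (label_at f i).
Proof.
have [lt|ge] := ltnP i (arity X).
  by rewrite -[i]/(val (Ordinal lt)) !perm_at_ord !label_at_ord ocompE.
by rewrite !(label_at_out _ ge) ocomp0r.
Qed.

Lemma perm_at_tens X X' Y Y' (f : fhom X X') (g : fhom Y Y') i :
  perm_at (ftens f g) i =
  if i < arity X then perm_at f i else arity X + perm_at g (i - arity X).
Proof.
have [lt|ge] := ltnP i (arity X + arity Y); last first.
  rewrite perm_at_out // ltnNge (leq_trans (leq_addr _ _) ge) /= perm_at_out; lia.
rewrite -[i]/(val (Ordinal lt)) (@perm_at_ord (flist_cat X Y)) /= /ftens_perm.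
case: (splitP (Ordinal lt)) => j /= -> /=; rewrite ?ltn_ord ?perm_at_ord //.
by rewrite addKn perm_at_ord (fhom_arity f).
Qed.

Lemma label_at_tens X X' Y Y' (f : fhom X X') (g : fhom Y Y') i :
  label_at (ftens f g) i = if i < arity X then label_at f i else label_at g (i - arity X).
Proof.
have [lt|ge] := ltnP i (arity X + arity Y); last first.
  rewrite label_at_out // ltnNge (leq_trans (leq_addr _ _) ge) /= label_at_out //; lia.
rewrite -[i]/(val (Ordinal lt)) (@label_at_ord (flist_cat X Y)) /= Arr_castm.
case: (splitP (Ordinal lt)) => j /= -> /=; rewrite ?ltn_ord ?label_at_ord //.
by rewrite addKn label_at_ord.
Qed.

Lemma perm_at_sym X Y i :
  perm_at (fsym X Y) i =
  if i < arity X then arity Y + i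
  else if i < arity X + arity Y then i - arity X else i.
Proof.
have [lt|ge] := ltnP i (arity X + arity Y); last first.
  rewrite perm_at_out // ltnNge (leq_trans (leq_addr _ _) ge) //=.
rewrite -[i]/(val (Ordinal lt)) (@perm_at_ord (flist_cat X Y)) /= /fsym_perm.
case: (splitP (Ordinal lt)) => j /= -> /=; by rewrite ?addKn.
Qed.

Lemma label_at_sym X Y i :
  label_at (fsym X Y) i = omap (fun A => Arr (idm A)) (entry_at (flist_cat X Y) i).
Proof.
have [lt|ge] := ltnP i (arity X + arity Y); last first.
  by rewrite label_at_out // entry_at_out.
rewrite -[i]/(val (Ordinal lt)) (@label_at_ord (flist_cat X Y)).
by rewrite (@entry_at_ord _ (flist_cat X Y)) /= Arr_castm.
Qed.

(** * Category, tensor and symmetry axioms of the free category *)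

Let HC := category_axioms C.

Lemma FTr_category : is_category (FTr C).
Proof.
split=> [X Y f|X Y f|X Y Z W f g h]; apply: arr_inj; apply: fhom_eq => //=.
- by rewrite msetD0.
- move=> i; rewrite label_at_comp; case e: (entry_at Y (perm_at f i)) (label_at_cod f i) => [A|] E.
    by rewrite (label_at_idE e) (ocomp_idl HC).
  by move: E; case: (label_at f i) => // _; rewrite ocomp0r.
- by rewrite mset0D.
- move=> i; rewrite label_at_comp perm_at_id; case e: (entry_at X i) (label_at_dom f i) => [A|] E.
    by rewrite (label_at_idE e) (ocomp_idr HC).
  by move: E; case: (label_at f i) => // _; rewrite ocomp0r.
- by rewrite msetDA.
- by move=> i; rewrite !label_at_comp perm_at_comp (ocompA HC).
Qed.

Lemma FTr_strict_monoidal : is_strict_monoidal (FTr C).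
Proof.
unshelve econstructor.
- exact: flist_catA.
- exact: flist_cat0l.
- exact: flist_cat0r.
- move=> X Y; apply: arr_inj; apply: fhom_eq => //=.
  + by rewrite mset0D.
  + move=> i; rewrite perm_at_tens !perm_at_id; case: ltnP => //; lia.
  + move=> i; rewrite label_at_tens !label_at_id entry_at_cat; case: ltnP => //.
- move=> X Y Z X' Y' Z' f g f' g'; apply: arr_inj; apply: fhom_eq => //=.
  + by rewrite msetDACA.
  + move=> i; rewrite perm_at_comp !perm_at_tens !perm_at_comp -(fhom_arity f).
    case: ltnP => ge; first by rewrite perm_at_lt ge.
    by rewrite ltnNge leq_addr /= addKn.
  + move=> i; rewrite label_at_comp !label_at_tens !label_at_comp perm_at_tens -(fhom_arity f).
    case: ltnP => ge; first by rewrite perm_at_lt ge.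
    by rewrite ltnNge leq_addr /= addKn.
- move=> X Y Z X' Y' Z' f g h; apply: arr_inj; rewrite Arr_castm.
  apply: fhom_eq => /=; try exact: flist_catA.
  + by rewrite msetDA.
  + move=> i; rewrite !perm_at_tens /= subnDA; do !case: ifP; try lia; done.
  + move=> i; rewrite !label_at_tens /= subnDA; do !case: ifP; try lia; done.
- move=> X Y f; apply: arr_inj; rewrite Arr_castm; apply: fhom_eq => /=;
    try exact: flist_cat0l.
  + by rewrite mset0D.
  + by move=> i; rewrite perm_at_tens /= subn0.
  + by move=> i; rewrite label_at_tens /= subn0.
- move=> X Y f; apply: arr_inj; rewrite Arr_castm; apply: fhom_eq => /=;
    try exact: flist_cat0r.
  + by rewrite msetD0.
  + move=> i; rewrite perm_at_tens perm_at_id; case: ltnP => // ge; rewrite perm_at_out //; lia.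
  + by move=> i; rewrite label_at_tens; case: ltnP => // ge; rewrite label_at_id entry_at_nil label_at_out.
Qed.

Lemma ocomp_omap_id (x y z : option C) : x = y -> x = z ->
  omap (fun A => Arr (idm A)) x =
  ocomp (omap (fun A => Arr (idm A)) y) (omap (fun A => Arr (idm A)) z).
Proof. by move=> <- <-; case: x => //= A; rewrite ocompE (comp_idl HC). Qed.

Lemma FTr_symmetric : is_symmetric FTr_strict_monoidal.
Proof.
split.
- move=> X X' Y Y' f g; apply: arr_inj; apply: fhom_eq => //=.
  + by rewrite mset0D msetD0 msetDC.
  + move=> i; rewrite !perm_at_comp !perm_at_sym !perm_at_tens -(fhom_arity f) -(fhom_arity g).
    case: (ltnP i) => lt; first by rewrite perm_at_lt lt ltnNge leq_addr addKn.
    rewrite ltnNge leq_addr /= addKn ltn_add2l perm_at_lt.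
    have -> : (i - arity X < arity Y) = (i < arity X + arity Y) by lia.
    case: (ltnP i) => lt'; first by rewrite ifT //; lia.
    rewrite (perm_at_out g); last lia.
    rewrite ifF ?perm_at_out; lia.
  + move=> i; rewrite !label_at_comp !label_at_sym !label_at_tens perm_at_sym !perm_at_tens !entry_at_cat.
    rewrite -(fhom_arity f).
    case: (ltnP i) => lt.
      rewrite perm_at_lt lt ltnNge leq_addr addKn /=.
      have := label_at_dom f i; have := label_at_cod f i.
      case: (label_at f i) => [[A B h]|] /= <- <- /=; last by rewrite ocomp0r.
      by rewrite !ocompE (comp_idl HC) (comp_idr HC).
    rewrite ltnNge leq_addr /= addKn.
    have := label_at_dom g (i - arity X); have := label_at_cod g (i - arity X).
    case: (ltnP i) => lt'.
      rewrite ifT; last lia.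
      case: (label_at g _) => [[A B h]|] /= <- <- /=; last by rewrite ocomp0r.
      by rewrite !ocompE (comp_idl HC) (comp_idr HC).
    rewrite (@label_at_out _ _ g) /=; last lia.
    by move=> _ <-; rewrite !ocomp0r.
- move=> X Y; apply: arr_inj; apply: fhom_eq => //=.
  + by rewrite mset0D.
  + move=> i; rewrite perm_at_comp perm_at_id !perm_at_sym.
    case_ifs; lia.
  + move=> i; rewrite label_at_comp label_at_id !label_at_sym perm_at_sym !entry_at_cat.
    case: (ltnP i (arity X)) => lt.
      rewrite ltnNge leq_addr addKn /=; case: (entry_at X i) => //= A.
      by rewrite ocompE (comp_idl HC).
    case: (ltnP i (arity X + arity Y)) => lt'.
      rewrite ifT; last lia.
      case: (entry_at Y _) => //= A.
      by rewrite ocompE (comp_idl HC).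
    rewrite [entry_at Y (i - arity X)]entry_at_out ?ocomp0r //; lia.
- move=> X Y Z; apply: arr_inj; rewrite Arr_castm; apply: fhom_eq => /=;
    rewrite ?flist_catA //.
  + by rewrite floops_castm /= !mset0D.
  + move=> i; rewrite perm_at_comp perm_at_castm !perm_at_tens /= !perm_at_id !perm_at_sym /=.
    case_ifs; lia.
  + move=> i; rewrite label_at_comp perm_at_castm label_at_castm !label_at_tens !perm_at_tens /=.
    rewrite !label_at_id !perm_at_id !perm_at_sym !label_at_sym !entry_at_cat /=; case_ifs;
      try (exfalso; lia); apply: ocomp_omap_id; congr (entry_at _ _); lia.
- move=> X; apply: arr_inj; rewrite Arr_castm; apply: fhom_eq => /=.
  + by rewrite flist_cat0r.
  + by rewrite flist_cat0l.
  + by [].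
  + move=> i; rewrite perm_at_sym perm_at_id /=; case_ifs; lia.
  + by move=> i; rewrite label_at_sym label_at_id flist_cat0r.
Qed.

End Views.

(** * Sums of multisets and their reindexing *)

HB.instance Definition _ (K : choiceType) :=
  Monoid.isComLaw.Build {mset K} mset0 (@msetD K)
    (@msetDA K) (@msetDC K) (@mset0D K).

Section BigRel.
Variables (M : Type) (idx : M) (op : Monoid.com_law idx).

(** Reindexing along a one-to-one correspondence given as a relation, without choosing a function.
    Each [w x] is a one-term sum over the partners of x; after exchanging the sums, the inner one
    has one term again. *)
Lemma big_rel (I J : finType) (P : pred I) (Q : pred J) (E : I -> J -> Prop)
    (w : I -> M) (w' : J -> M) :
  (forall x, P x -> exists2 y, Q y & E x y) ->
  (forall y, Q y -> exists2 x, P x & E x y) ->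
  (forall x y y', P x -> Q y -> Q y' -> E x y -> E x y' -> y = y') ->
  (forall x x' y, P x -> P x' -> Q y -> E x y -> E x' y -> x = x') ->
  (forall x y, P x -> Q y -> E x y -> w x = w' y) ->
  \big[op/idx]_(x | P x) w x = \big[op/idx]_(y | Q y) w' y.
Proof.
move=> exy exx uy ux eqw.
have step1 x : P x -> w x = \big[op/idx]_(y | Q y && `[<E x y>]) w' y.
  move=> Px; have [y Qy Exy] := exy x Px.
  rewrite (eqw _ _ Px Qy Exy) (big_pred1 y) // => z /=.
  apply/andP/eqP => [[Qz /asboolP Exz]|->]; first exact: (uy x).
  by split=> //; apply/asboolP.
rewrite (eq_bigr _ step1) (exchange_big_dep Q) /=; last by move=> x y _ /andP[].
apply: eq_bigr => y Qy; have [x Px Exy] := exx y Qy.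
rewrite (big_pred1 x) // => z /=; rewrite Qy /=.
apply/andP/eqP => [[Pz /asboolP Ezy]|->]; first exact: (ux _ _ y).
by split=> //; apply/asboolP.
Qed.

End BigRel.

(** * Trails and cycles *)

Section Trails.
Variable C : category.
Implicit Types (s : nat -> nat) (l : nat -> option (arr C)) (R : pred nat).

(* [trail s l R i j h]: starting from i, the successive images under s lie in R
   until the first one outside R, which is j; h is the composite of the labels
   met on the way. *)
Inductive trail s l R : nat -> nat -> option (arr C) -> Prop :=
| trail1 i : ~~ R (s i) -> trail s l R i (s i) (l i)
| trailS i j h : R (s i) -> trail s l R (s i) j h ->
    trail s l R i j (ocomp h (l i)).

Lemma trail_inv s l R i j h : trail s l R i j h ->
  if R (s i) then exists2 h', trail s l R (s i) j h' & h = ocomp h' (l i)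
  else j = s i /\ h = l i.
Proof. by case=> [{}i /negbTE-> //|{}i {}j {}h -> t]; exists h. Qed.

Lemma trail_det s l R i j h j' h' :
  trail s l R i j h -> trail s l R i j' h' -> j = j' /\ h = h'.
Proof.
move=> t; elim: t j' h' => {i j h}
    [i /negbTE nR|i j h Ri _ IH] j' h' /trail_inv.
  by rewrite nR => -[-> ->].
by rewrite Ri => -[h'' /IH[-> ->] ->].
Qed.

Lemma trail_out s l R i j h : trail s l R i j h -> ~~ R j.
Proof. by elim. Qed.

Fixpoint walk s l k i : option (arr C) :=
  if k is k'.+1 then ocomp (l (iter k'.+1 s i)) (walk s l k' i) else l i.

(** [walk], like [fwalk], grows at its end, while [trail] grows at its start; associativity of
    [ocomp] reconciles them. *)
Lemma walkSr s l k i : walk s l k.+1 i = ocomp (walk s l k (s i)) (l i).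
Proof.
elim: k => [//|k IHk].
rewrite -[LHS]/(ocomp (l (iter k.+2 s i)) (walk s l k.+1 i)) IHk.
by rewrite (ocompA (category_axioms C)) iterSr.
Qed.

Lemma trail_walk s l R k i :
  (forall t, 0 < t <= k -> R (iter t s i)) -> ~~ R (iter k.+1 s i) ->
  trail s l R i (iter k.+1 s i) (walk s l k i).
Proof.
elim: k i => [|k IHk] i Rt nR; first exact: trail1.
rewrite walkSr iterSr; apply: trailS; first exact: (Rt 1).
apply: IHk => [t /andP[t0 tk]|]; last by rewrite -iterSr.
by rewrite -iterSr; apply: Rt; rewrite ltnS.
Qed.

Lemma trailP s l R i j h : trail s l R i j h -> exists k,
  [/\ j = iter k.+1 s i, h = walk s l k i
    & forall t, 0 < t <= k -> R (iter t s i)].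
Proof.
elim=> {i j h} [i nR|i j h Ri _ [k [-> -> Rt]]].
  by exists 0; split=> // t; case: t.
exists k.+1; split; rewrite ?walkSr -?iterSr // => t.
case: t => // -[|t] // tk; rewrite iterSr; apply: Rt; move: tk; lia.
Qed.

Lemma trail_ex s l R i k : ~~ R (iter k.+1 s i) -> exists j h, trail s l R i j h.
Proof.
elim: k i => [|k IHk] i nR; first by exists (s i), (l i); apply: trail1.
case: (boolP (R (s i))) => Ri; last by exists (s i), (l i); apply: trail1.
have [|j [h t]] := IHk (s i); first by rewrite -iterSr.
by exists j, (ocomp h (l i)); apply: trailS.
Qed.

(** What remains of finiteness once a permutation of an initial segment is extended by the identity
    to all natural numbers. *)
Definition periodic s := forall x, exists k, iter k.+1 s x = x.

Lemma periodic_inv s x y k : periodic s -> iter k s x = y ->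
  exists k', iter k' s y = x.
Proof.
move=> ps; elim: k x y => [|k IHk] x y /=; first by move=> ->; exists 0.
move=> <-; have [k' ek'] := IHk x _ erefl; have [p ep] := ps (iter k s x).
by exists (k' + p); rewrite iterD -iterSr ep.
Qed.

(* A cycle is represented by its least element. As opposed to an arbitrary choice
   of representatives this is compatible with the splitting of the feedback part
   into U and V: the cycles hitting U are represented in U. *)
Definition rep s j := forall k, j <= iter k s j.

Lemma rep_ex s x : exists k, rep s (iter k s x).
Proof.
have ex : exists v, `[< exists k, iter k s x = v >].
  by exists x; apply/asboolP; exists 0.
case: (ex_minnP ex) => v /asboolP[k ek] vmin; exists k => k'.
by rewrite -iterD ek; apply: vmin; apply/asboolP; exists (k' + k).
Qed.

Lemma rep_uniq s x y k : periodic s -> rep s x -> rep s y ->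
  iter k s x = y -> x = y.
Proof.
move=> ps rx ry e; have [k' e'] := periodic_inv ps e.
by apply/eqP; rewrite eqn_leq -{1}e rx -e' ry.
Qed.

(** Asking the trail through the numbers above j to end at j singles out the least element of a
    cycle and computes its loop in one go, so that cycles obey the same transfer lemmas as
    trails. *)
Definition cyc s l j : {mset loops C} :=
  match pselect (exists h, trail s l (ltn j) j j h) with
  | left e => oloop (projT1 (cid e))
  | right _ => mset0
  end.

Lemma cycT s l j h : trail s l (ltn j) j j h -> cyc s l j = oloop h.
Proof.
rewrite /cyc => t; case: pselect => [e|[]]; last by exists h.
by case: cid => h' /= /(trail_det t)[_ ->].
Qed.

Lemma cyc0 s l j k h : trail s l (ltn j) j k h -> k <> j -> cyc s l j = mset0.
Proof.
rewrite /cyc => t nkj; case: pselect => // e; exfalso; apply: nkj.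
by case: e => h' t'; case: (trail_det t t').
Qed.

Lemma eq_cyc s l s' l' j j' : 
  (forall h, trail s l (ltn j) j j h <-> trail s' l' (ltn j') j' j' h) ->
  cyc s l j = cyc s' l' j'.
Proof.
move=> e; rewrite /cyc; case: pselect => [ex|ne].
  by case: cid => h' /= /e t'; rewrite -/(cyc s' l' j') (cycT t').
case: pselect => // ex; exfalso; apply: ne.
by case: ex => h /e t; exists h.
Qed.

(** One full turn from an arbitrary point of a cycle. As opposed to [cyc], which sees only the least
    element, it can be rotated. *)
Definition lap s l j h := trail s l (predC1 j) j j h.

Lemma lap_ex s l j : periodic s -> exists h, lap s l j h.
Proof.
move=> ps; have [k ek] := ps j.
have [|j' [h t]] := @trail_ex s l (predC1 j) j k; first by rewrite ek /= eqxx.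
have := trail_out t; rewrite /= negbK => /eqP ej; subst j'; by exists h.
Qed.

Lemma lapP s l j h : lap s l j h -> exists k,
  [/\ iter k.+1 s j = j, h = walk s l k j
    & forall t, 0 < t <= k -> iter t s j <> j].
Proof.
case/trailP => k [ek -> ne]; by exists k; split=> // t /ne /= /eqP.
Qed.

Lemma walk_lap s l j k : iter k.+1 s j = j ->
  (forall t, 0 < t <= k -> iter t s j <> j) -> lap s l j (walk s l k j).
Proof.
move=> ek ne; rewrite /lap -{3}ek; apply: trail_walk => [t /ne|] /=; first by move/eqP.
by rewrite -iterS ek eqxx.
Qed.

(** From a least element, the trail that stops on returning to j and the trail that stops on not
    exceeding j are the same. *)
Lemma lap_cyc s l j h : rep s j -> lap s l j h -> cyc s l j = oloop h.
Proof.
move=> rj /lapP[k [ek -> ne]]; apply: cycT; rewrite -{3}ek.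
apply: trail_walk => [t /ne|]; last by rewrite ek /= ltnn.
by move=> /eqP ne'; rewrite /= ltn_neqAle eq_sym ne' rj.
Qed.

(** The orbit goes below j, so the trail through the numbers above j ends; if it ended at j,
    periodicity would keep the whole orbit at or above j. *)
Lemma cyc_nrep s l j : periodic s -> ~ rep s j -> cyc s l j = mset0.
Proof.
move=> ps nr; have [k /negP lt] : exists k, ~ (j <= iter k s j).
  by apply: contrapT => ne; apply: nr => k; apply: contrapT => nk; case: ne; exists k.
case: k lt => [|k] lt; first by rewrite /= leqnn in lt.
have [|j' [h t]] := @trail_ex s l (ltn j) j k.
  by rewrite /= -ltnNge in lt; rewrite /= -leqNgt ltnW.
apply: (cyc0 t) => ej; subst j'; case/trailP: t => p [ep _ Rt].
suff all q : j <= iter q s j by rewrite all in lt.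
elim/ltn_ind: q => q IHq; have [le|gt] := leqP q p.
  by case: q le {IHq} => [//|q] le; apply/ltnW/Rt.
rewrite -(subnK gt) iterD -ep; apply: IHq; lia.
Qed.

(** Moving the starting point by one step moves the first label to the end, a rotation that [oloopC]
    absorbs. *)
Lemma lap_step s l j h : injective s -> lap s l j h ->
  exists2 h', lap s l (s j) h' & oloop h = oloop h'.
Proof.
move=> si /lapP[k [ek -> ne]]; exists (walk s l k (s j)).
  apply: walk_lap => [|t /ne]; first by rewrite -iterSr iterS ek.
  by rewrite -iterSr iterS => ne' /si.
case: k ek {ne} => [|k] ek; first by move: ek => /= ->.
rewrite walkSr (oloopC (category_axioms C)) [in RHS]/=.
by rewrite -[s (iter k s (s j))]iterS -iterSr ek.
Qed.

Lemma lap_iter s l j h k : injective s -> lap s l j h ->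
  exists2 h', lap s l (iter k s j) h' & oloop h = oloop h'.
Proof.
move=> si lj; elim: k => [|k [h' l' e]]; first by exists h.
by have [h'' l'' e'] := lap_step si l'; exists h''; rewrite ?e.
Qed.

End Trails.

(** * Comparison of the trails and cycles of two systems *)

Section TrailMoves.
Variable C : category.
Implicit Types (s : nat -> nat) (l : nat -> option (arr C)) (R : pred nat).

Let HC := category_axioms C.

(** For input naturality: the feedback part is untouched, so only the first label of a trail
    changes. *)
Lemma trail_pre s l s' l' R i i' j h x :
  s' i' = s i -> l' i' = ocomp (l i) x ->
  (forall y, R y -> s' y = s y /\ l' y = l y) ->
  trail s l R i j h -> trail s' l' R i' j (ocomp h x).
Proof.
move=> es el e /trail_inv; case: ifP => [Rsi [h' t ->]|/negbT nR [-> ->]]; last first.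
  by rewrite -el -es; apply: trail1; rewrite es.
rewrite -(ocompA HC) -el; apply: trailS; rewrite es //.
elim: t Rsi => {i j h' es el} [i nR|i j h' Rsi _ IH] Ri; have [es el] := e _ Ri.
  by rewrite -es -el; apply: trail1; rewrite es.
by rewrite -el; apply: trailS; rewrite es //; apply: IH.
Qed.

(** For output naturality: only the step that leaves the feedback part changes, both in its label
    and, through [G], in its end. *)
Lemma trail_post s l s' l' R G x i j h :
  (forall y, R (s y) -> s' y = s y /\ l' y = l y) ->
  (forall y, ~~ R (s y) ->
    [/\ ~~ R (s' y), s' y = G (s y) & l' y = ocomp (x (s y)) (l y)]) ->
  trail s l R i j h -> trail s' l' R i (G j) (ocomp (x j) h).
Proof.
move=> e1 e2; elim=> {i j h} [i nR|i j h Ri _ IH].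
  by have [nR' <- <-] := e2 _ nR; apply: trail1.
have [es el] := e1 _ Ri; rewrite (ocompA HC) -el; apply: trailS; rewrite es //.
Qed.

(** Agreement is required only for steps into R or to the end j, the only ones that the trail makes.
    In output naturality the steps leaving the feedback part do differ, yet cycles never take
    them. *)
Lemma trail_ext_to s l s' l' R i j h :
  (forall x, x = i \/ R x -> R (s x) \/ s x = j -> s' x = s x /\ l' x = l x) ->
  trail s l R i j h -> trail s' l' R i j h.
Proof.
move=> e t; elim: t e => {i j h} [i nR|i j h Ri _ IH] e.
  have [<- <-] : s' i = s i /\ l' i = l i by apply: e; [left|right].
  apply: trail1; have [-> _] // : s' i = s i /\ l' i = l i.
  by apply: e; [left|right].
have [es <-] : s' i = s i /\ l' i = l i by apply: e; left.
apply: trailS; rewrite es //; apply: IH => x [->|Rx] Rs; apply: e => //; by right.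
Qed.

Lemma cyc_ext n s l s' l' j : n <= j ->
  (forall x, n <= x -> n <= s x \/ n <= s' x -> s' x = s x /\ l' x = l x) ->
  cyc s l j = cyc s' l' j.
Proof.
move=> nj e; apply: eq_cyc => h.
have nle x : x = j \/ ltn j x -> n <= x.
  by case=> [->|/ltnW]; last exact: leq_trans.
split; apply: trail_ext_to => x /nle nx.
  by move=> sx; apply: e => //; left; apply: nle; case: sx; [right|left].
move=> sx; have [] : s' x = s x /\ l' x = l x; last by move=> -> ->.
by apply: e => //; right; apply: nle; case: sx; [right|left].
Qed.

Lemma trail_sub s l R R' i j h : (forall y, R y -> R' y) -> ~~ R' j ->
  trail s l R i j h -> trail s l R' i j h.
Proof.
move=> sub nR' t; elim: t nR' => {i j h} [i nR|i j h Ri _ IH] nR'.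
  exact: trail1.
by apply: trailS; [apply: sub|apply: IH].
Qed.

Lemma trail_cat s l R R' i k h j h' : (forall y, R y -> R' y) -> R' k ->
  trail s l R i k h -> trail s l R' k j h' -> trail s l R' i j (ocomp h' h).
Proof.
move=> sub Rk t; elim: t Rk => {i k h} [i nR|i k h Ri _ IH] Rk t'.
  exact: trailS.
by rewrite (ocompA HC); apply: trailS; [apply: sub|apply: IH].
Qed.

(* s' is the map of first return of s to [0, N[, hence it has the same trails. *)
Lemma trail_return s l s' l' N R i j h :
  (forall i, i < N -> trail s l (leq N) i (s' i) (l' i)) ->
  (forall y, N <= y -> R y) -> i < N ->
  trail s' l' R i j h -> trail s l R i j h.
Proof.
move=> ret sub iN t; elim: t iN => {i j h} [i nR|i j h Ri _ IH] iN.
  exact: trail_sub (ret i iN).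
apply: (trail_cat _ Ri (ret i iN)) => //; apply: IH.
by have := trail_out (ret i iN); rewrite -ltnNge.
Qed.

(** Trails transfer in one direction only, from s' to s. Periodicity of s' supplies a trail that
    certainly ends, and determinism lets it decide both sides, whether or not it ends at j. *)
Lemma cyc_return s l s' l' N j :
  (forall i, i < N -> trail s l (leq N) i (s' i) (l' i)) ->
  periodic s' -> j < N -> cyc s l j = cyc s' l' j.
Proof.
move=> ret ps jN; have [k ek] := ps j.
have [|j' [h t]] := @trail_ex _ s' l' (ltn j) j k; first by rewrite ek /= ltnn.
have t' : trail s l (ltn j) j j' h.
  by apply: (trail_return ret _ jN t) => y; apply: leq_trans jN.
have [ej|ne] := eqVneq j' j; last by rewrite (cyc0 t) ?(cyc0 t') //; apply/eqP.
by subst j'; rewrite (cycT t) (cycT t').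
Qed.

Lemma trail_shift s l s' l' R R' w i j h :
  (forall x, s' (w + x) = w + s x) -> (forall x, l' (w + x) = l x) ->
  (forall x, R' (w + x) = R x) ->
  trail s l R i j h -> trail s' l' R' (w + i) (w + j) h.
Proof.
move=> es el eR; elim=> {i j h} [i nR|i j h Ri _ IH].
  by rewrite -es -el; apply: trail1; rewrite es eR.
by rewrite -el; apply: trailS; rewrite es ?eR.
Qed.

Lemma trail_unshift s l s' l' R R' w i j h :
  (forall x, s' (w + x) = w + s x) -> (forall x, l' (w + x) = l x) ->
  (forall x, R' (w + x) = R x) ->
  trail s' l' R' (w + i) j h -> exists2 j', j = w + j' & trail s l R i j' h.
Proof.
move=> es el eR; move ei: (w + i) => i' t; elim: t i ei => {i' j h}
    [i' nR i ei|i' j h Ri _ IH i ei]; subst i'.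
  exists (s i); first by rewrite es.
  by rewrite el; apply: trail1; rewrite -eR -es.
have [|j' ej t] := IH (s i); first by rewrite es.
by exists j' => //; rewrite el; apply: trailS; rewrite // -eR -es.
Qed.

Lemma cyc_shift s l s' l' w j :
  (forall x, s' (w + x) = w + s x) -> (forall x, l' (w + x) = l x) ->
  cyc s' l' (w + j) = cyc s l j.
Proof.
move=> es el; apply: eq_cyc => h.
have eR x : ltn (w + j) (w + x) = ltn j x by rewrite /= ltn_add2l.
split; last exact: trail_shift.
by case/(trail_unshift es el eR) => j' /addnI <-.
Qed.

End TrailMoves.

(** * The trace of the free category *)

Section TraceViews.
Variable C : category.

Lemma perm_at_periodic (X Y : flist C) (f : fhom X Y) : periodic (perm_at f).
Proof.
move=> x; have [lt|ge] := ltnP x (arity X); last by exists 0; rewrite /= perm_at_out.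
have it k : iter k (perm_at f) x = iter k (fendo f) (Ordinal lt).
  by elim: k => //= k ->; rewrite perm_at_ord.
exists (order (fendo f) (Ordinal lt)).-1; rewrite it prednK ?order_gt0 //.
by rewrite iter_order //; apply: fendo_inj.
Qed.

Variables (U A B : flist C).
Variable f : fhom (flist_cat A U) (flist_cat B U).

Local Notation n := (arity A).
Local Notation m := (arity U).

Lemma iter_perm_at k (j : 'I_(n + m)) : iter k (perm_at f) j = iter k (fendo f) j.
Proof. by elim: k => //= k ->; rewrite (@perm_at_ord _ (flist_cat A U)). Qed.

Lemma fwalk_view k (j : 'I_(n + m))
    (h : forall l, (0 < l <= k)%N -> (n <= iter l (fendo f) j)%N) :
  Some (Arr (fwalk h)) = walk (perm_at f) (label_at f) k j.
Proof.
elim: k h => [|k IHk] h; first by rewrite /= (@label_at_ord _ (flist_cat A U)).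
(* The proof term from the body of [fwalk], repeated so that the induction hypothesis speaks of the
   recursive call itself. *)
pose h' l (lk : (0 < l <= k)%N) := h l (introT andP
  (conj (proj1 (andP lk)) (leqW (proj2 (andP lk))))).
rewrite -[RHS]/(ocomp (label_at f (iter k.+1 (perm_at f) j)) (walk (perm_at f) (label_at f) k j)).
rewrite -(IHk h') iter_perm_at (@label_at_ord _ (flist_cat A U)).
exact: esym (ocomp_typed _ _ (feedback_entry (h k.+1 (leqnn k.+1)))).
Qed.

Lemma ftr_trail i : i < n ->
  trail (perm_at f) (label_at f) (leq n) i (perm_at (ftr f) i) (label_at (ftr f) i).
Proof.
move=> lt; pose j : 'I_n := Ordinal lt.
rewrite -[i]/(val j) (@perm_at_ord _ A) (@label_at_ord _ A) [flabel _ _]/=.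
rewrite /ftr_label Arr_castm fwalk_view.
have -> : fperm (ftr f) j = iter (fexit_time f j).+1 (perm_at f) (lshift m j) :> nat.
  by rewrite iter_perm_at.
apply: (@trail_walk _ _ _ _ _ (lshift m j)) => [t tk|].
  by rewrite iter_perm_at; apply: fexit_ge.
by rewrite iter_perm_at /= -ltnNge [X in _ < X](ftr_arity f) fexit_lt.
Qed.

Definition cycs n m (s : nat -> nat) l :=
  \big[@msetD (loops C)/mset0]_(n <= j < n + m) cyc s l j.

(** [froots] and [rep] both select one element per cycle, but not the same one. Selected elements
    are matched when they share a cycle, and their loops agree by rotation. A cycle lies in the
    feedback part exactly when its least element does. *)
Lemma ftr_loopsE : ftr_loops f = cycs n m (perm_at f) (label_at f).
Proof.
rewrite /cycs big_geq_mkord /ftr_loops.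
rewrite [LHS](bigID (fun j => `[< in_feedback f j >])) /=.
rewrite [X in msetD _ X]big1 ?msetD0; last first.
  move=> j /andP[_ /asboolPn nf]; by case: pselect.
rewrite [RHS](bigID (fun j : 'I_(n + m) => `[< rep (perm_at f) j >])) /=.
rewrite [X in _ = msetD _ X]big1 ?msetD0; last first.
  by move=> j /andP[_ /asboolPn nr]; apply: cyc_nrep => //; apply: perm_at_periodic.
have ps := perm_at_periodic f.
have fi := @fendo_inj _ _ _ f.
apply: (@big_rel _ _ _ _ _ _ _
    (fun j k : 'I_(n + m) => exists t, iter t (perm_at f) j = k)).
- move=> x /andP[_ /asboolP fx].
  have [k rk] := rep_ex (perm_at f) x; rewrite iter_perm_at in rk.
  exists (iter k (fendo f) x); last by exists k; rewrite iter_perm_at.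
  by apply/andP; split; [exact: fx|apply/asboolP].
- move=> y /andP[ny /asboolP ry]; exists (froot (fendo f) y).
    rewrite roots_root /=; last exact: fconnect_sym.
    apply/asboolP => l.
    have /iter_findex <- : fconnect (fendo f) y (froot (fendo f) y).
      exact: connect_root.
    by rewrite -iterD; apply: leq_trans ny _; rewrite -iter_perm_at.
  have /iter_findex e : fconnect (fendo f) (froot (fendo f) y) y.
    by rewrite fconnect_sym // connect_root.
  exists (findex (fendo f) (froot (fendo f) y) y).
  by rewrite (iter_perm_at _ (froot (fendo f) y)) e.
- move=> x y y' _ /andP[_ /asboolP ry] /andP[_ /asboolP ry'] [t e] [t' e'].
  have [p ep] := periodic_inv ps e.
  apply: val_inj; apply: (@rep_uniq _ _ _ (t' + p)) => //.
  by rewrite iterD ep.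
- move=> x x' y /andP[/eqP rx _] /andP[/eqP rx' _] _ [t e] [t' e'].
  have con (z : 'I_(n + m)) k : iter k (perm_at f) z = y -> fconnect (fendo f) z y.
    by rewrite iter_perm_at => /val_inj <-; apply: fconnect_iter.
  rewrite -rx -rx'; apply/(fun P => rootP P); first exact: fconnect_sym.
  apply: (connect_trans (con _ _ e)); rewrite fconnect_sym //; exact: con e'.
- move=> x y /andP[_ /asboolP fx] /andP[_ /asboolP ry] [t e].
  case: pselect => // h.
  have lx : lap (perm_at f) (label_at f) x (Some (Arr
      (fwalk (fun l (_ : 0 < l <= (order (fendo f) x).-1) => h l)))).
    rewrite fwalk_view; apply: walk_lap.
      by rewrite iter_perm_at prednK ?order_gt0 // iter_order.
    move=> p /andP[p0 lp]; rewrite iter_perm_at => /val_inj ex.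
    have lt : p < order (fendo f) x.
      by have := order_gt0 (fendo f) x; move: lp p0; case: order => //; lia.
    by have := findex_iter lt; rewrite ex findex0 => p0'; rewrite -p0' in p0.
  have [h' ly eh] := lap_iter t (@perm_at_inj _ _ _ f) lx.
  rewrite e in ly; rewrite (lap_cyc ry ly) -eh.
  by rewrite -[in RHS](Arr_castm erefl (floop_tgt h)) oloopE.
Qed.

(** The form in which every trace axiom is proved: trails being deterministic, it suffices to
    exhibit the entries of g as trails of f. *)
Lemma ftr_eq (g : fhom A B) : floops f `+` cycs n m (perm_at f) (label_at f) = floops g ->
  (forall i, i < n -> trail (perm_at f) (label_at f) (leq n) i (perm_at g i) (label_at g i)) ->
  ftr f = g.
Proof.
move=> eS et; apply: (@arr_inj (FTr C)); apply: fhom_eq => //=.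
- by rewrite ftr_loopsE.
- move=> i; have [lt|ge] := ltnP i n; last by rewrite !perm_at_out.
  by have [] := trail_det (ftr_trail lt) (et i lt).
- move=> i; have [lt|ge] := ltnP i n; last by rewrite !label_at_out.
  by have [] := trail_det (ftr_trail lt) (et i lt).
Qed.

End TraceViews.

(* Feedback dinaturality compares G \o phi with phi \o G: the map G carries the
   cycles of the latter to those of the former, up to a rotation of the labels. *)
Section CyclesOfConjugates.
Variable C : category.
Variables (n m : nat) (s1 s2 phi G : nat -> nat).
Variables (l1 l2 lphi lG lG' : nat -> option (arr C)).
Hypothesis s1E : forall x, s1 x = G (phi x).
Hypothesis s2E : forall x, s2 x = phi (G x).
Hypothesis l1E : forall x, l1 x = ocomp (lG (phi x)) (lphi x).
Hypothesis l2E : forall x, l2 x = ocomp (lphi (G x)) (lG' x).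
Hypothesis lGE : forall x, n <= x -> lG x = lG' x.
Hypothesis G_inj : injective G.
Hypothesis G_per : periodic G.
Hypothesis s1_inj : injective s1.
Hypothesis s1_per : periodic s1.
Hypothesis s2_per : periodic s2.
Hypothesis G_ge : forall x, (n <= G x) = (n <= x).
Hypothesis G_lt : forall x, (G x < n + m) = (x < n + m).
Hypothesis s1_lt : forall x, (s1 x < n + m) = (x < n + m).

Let HC := category_axioms C.

Lemma iter_conj k x : iter k s1 (G x) = G (iter k s2 x).
Proof. by elim: k => //= k ->; rewrite s1E s2E. Qed.

Lemma iter_lt s k x : (forall x, (s x < n + m) = (x < n + m)) ->
  (iter k s x < n + m) = (x < n + m).
Proof. by move=> e; elim: k => //= k <-; rewrite e. Qed.

(** Both walks alternate the labels of [G] and of [phi]; one starts with a label of [G], the other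
    ends with one, and v is the part they share. Staying at or above n makes [lG] and [lG']
    interchangeable. *)
Lemma walk_conj k y : (forall t, n <= iter t s2 y) ->
  exists2 v, walk s2 l2 k y = ocomp v (lG' y)
    & walk s1 l1 k (G y) = ocomp (lG (iter k.+1 s2 y)) v.
Proof.
move=> ge; elim: k => [|k [v e2 e1]].
  by exists (lphi (G y)); rewrite /= ?l2E ?l1E ?s2E.
set z := iter k.+1 s2 y in e1.
exists (ocomp (lphi (G z)) (ocomp (lG' z) v)).
  by rewrite -[LHS]/(ocomp (l2 z) (walk s2 l2 k y)) e2 l2E !(ocompA HC).
rewrite -[LHS]/(ocomp (l1 (iter k.+1 s1 (G y))) (walk s1 l1 k (G y))) e1.
by rewrite iter_conj -/z l1E -(lGE (ge k.+1)) iterS -/z s2E !(ocompA HC).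
Qed.

Lemma lap_conj y h : (forall t, n <= iter t s2 y) -> lap s2 l2 y h ->
  exists2 h', lap s1 l1 (G y) h' & oloop h = oloop h'.
Proof.
move=> ge /lapP[k [ek -> ne]]; have [v e2 e1] := walk_conj k ge.
exists (walk s1 l1 k (G y)).
  apply: walk_lap => [|t /ne]; first by rewrite iter_conj ek.
  by rewrite iter_conj => ne' /G_inj.
by rewrite e2 e1 ek (lGE (ge 0)) (oloopC HC).
Qed.

(** [G] need not send least elements to least elements; hence x and y are matched when x lies on the
    [s1]-orbit of [G y]. *)
Lemma cycs_conj : cycs n m s1 l1 = cycs n m s2 l2.
Proof.
rewrite /cycs !big_geq_mkord /=.
rewrite [LHS](bigID (fun j : 'I_(n + m) => `[< rep s1 j >])) /=.
rewrite [X in msetD _ X]big1 ?msetD0; last first.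
  by move=> j /andP[_ /asboolPn nr]; apply: cyc_nrep.
rewrite [RHS](bigID (fun j : 'I_(n + m) => `[< rep s2 j >])) /=.
rewrite [X in _ = msetD _ X]big1 ?msetD0; last first.
  by move=> j /andP[_ /asboolPn nr]; apply: cyc_nrep.
apply: (@big_rel _ _ _ _ _ _ _
    (fun x y : 'I_(n + m) => exists t, iter t s1 (G y) = x)).
- move=> x /andP[nx /asboolP rx]; have [p ep] := G_per x.
  have [k rk] := rep_ex s2 (iter p G x).
  have Gy : G (iter k s2 (iter p G x)) = iter k s1 x.
    by rewrite -iter_conj -iterS ep.
  have lt : iter k s2 (iter p G x) < n + m by rewrite -G_lt Gy iter_lt.
  exists (Ordinal lt).
    apply/andP; split; last exact/asboolP.
    by rewrite -G_ge Gy; apply: leq_trans nx _; apply: rx.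
  by rewrite /= Gy; apply: (periodic_inv (k := k)).
- move=> y /andP[ny /asboolP ry]; have [k rk] := rep_ex s1 (G y).
  have lt : iter k s1 (G y) < n + m by rewrite iter_lt // G_lt.
  exists (Ordinal lt); last by exists k.
  apply/andP; split; last exact/asboolP.
  by rewrite /= iter_conj G_ge; apply: leq_trans ny _; apply: ry.
- move=> x y y' _ /andP[_ /asboolP ry] /andP[_ /asboolP ry'] [t e] [t' e'].
  move: e'; rewrite -e !iter_conj => /G_inj e'.
  have [p ep] := periodic_inv s2_per (erefl (iter t s2 y)).
  have [p' ep'] := periodic_inv s2_per (erefl (iter t' s2 y')).
  apply: val_inj; apply: (@rep_uniq s2 _ _ (p' + t)) => //.
  by rewrite iterD -e'.
- move=> x x' y /andP[_ /asboolP rx] /andP[_ /asboolP rx'] _ [t e] [t' e'].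
  have [p ep] := periodic_inv s1_per e.
  apply: val_inj; apply: (@rep_uniq s1 _ _ (t' + p)) => //.
  by rewrite iterD ep.
- move=> x y /andP[_ /asboolP rx] /andP[ny /asboolP ry] [t e].
  have [h ly] := lap_ex l2 y s2_per.
  have [|h' l' eh'] := lap_conj _ ly.
    by move=> k; apply: leq_trans ny _; apply: ry.
  have [h'' l'' eh''] := lap_iter t s1_inj l'.
  by rewrite e in l''; rewrite (lap_cyc rx l'') (lap_cyc ry ly) eh' eh''.
Qed.

(** The [s2] trail stays one application of [G] behind the [s1] trail, and its label lacks the
    corresponding [lG']. On exit the positions coincide because [G] fixes what lies below n. *)
Lemma trail_conj i j h i' : 
  (forall x, G (phi x) < n -> G (phi x) = phi x) ->
  (forall x, phi x < n -> ocomp (lG (phi x)) (lphi x) = lphi x) ->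
  trail s1 l1 (leq n) i j h -> G i' = i ->
  trail s2 l2 (leq n) i' j (ocomp h (lG' i')).
Proof.
move=> Glt lGlt t; elim: t i' => {i j h} [i nR|i j h Ri _ IH] i' ei'.
  have lt : G (phi i) < n by rewrite -s1E ltnNge.
  have lt' : phi i < n by rewrite -(Glt _ lt).
  have -> : s1 i = s2 i' by rewrite s1E s2E ei' Glt.
  have -> : ocomp (l1 i) (lG' i') = l2 i' by rewrite l1E l2E ei' lGlt.
  by apply: trail1; rewrite s2E ei' -ltnNge.
have ge : n <= phi i by rewrite -G_ge -s1E.
have -> : ocomp (ocomp h (l1 i)) (lG' i') = ocomp (ocomp h (lG' (phi i))) (l2 i').
  by rewrite l1E l2E ei' -(lGE ge) !(ocompA HC).
have e : s2 i' = phi i by rewrite s2E ei'.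
by apply: trailS; rewrite e //; apply: IH; rewrite s1E.
Qed.

End CyclesOfConjugates.

(** * The trace axioms in the free category *)

Section TraceAxioms.
Variable C : category.
Implicit Types A B U V W X Y Z : flist C.

Let HC := category_axioms C.
Let M := FTr_strict_monoidal C.

Lemma eq_cycs n m s l s' l' :
  (forall j, n <= j < n + m -> cyc s l j = cyc s' l' j) ->
  @cycs C n m s l = cycs n m s' l'.
Proof. by move=> e; apply: eq_big_nat. Qed.

Lemma cycs_shift n m s l s' l' w :
  (forall x, s' (w + x) = w + s x) -> (forall x, l' (w + x) = l x) ->
  @cycs C (w + n) m s' l' = cycs n m s l.
Proof.
move=> es el; rewrite /cycs -addnA [X in \big[_/_]_(X <= _ < _) _]addnC big_addn addKn.
by apply: eq_bigr => j _; rewrite addnC; apply: cyc_shift.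
Qed.

Lemma ocomp_idl_ent X Y Z (f : fhom X Y) i : Y = Z ->
  ocomp (label_at (fid Z) (perm_at f i)) (label_at f i) = label_at f i.
Proof.
move=> <-; have := label_at_cod f i; case e: (entry_at Y (perm_at f i)) => [A|].
  by move=> cdf; rewrite (label_at_idE e) (ocomp_idl HC).
by case: (label_at f i) => // _; rewrite ocomp0r.
Qed.

Lemma ocomp_idr_ent X Y (f : fhom X Y) i : ocomp (label_at f i) (label_at (fid X) i) = label_at f i.
Proof.
have := label_at_dom f i; case e: (entry_at X i) => [A|].
  by move=> dmf; rewrite (label_at_idE e) (ocomp_idr HC).
by case: (label_at f i) => // _; rewrite /ocomp.
Qed.

Lemma label_at_tens_idr A A' U (g : fhom A A') i : arity A <= i ->
  label_at (ftens g (fid U)) i = label_at (fid U) (i - arity A).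
Proof. by move=> ge; rewrite label_at_tens ltnNge ge. Qed.

Lemma ftr_input U A A' B (f : fhom (flist_cat A U) (flist_cat B U))
    (g : fhom A' A) :
  fcomp (ftr f) g = ftr (fcomp f (ftens g (fid U))).
Proof.
have eA := fhom_arity g.
have fb y : arity A' <= y ->
    perm_at (fcomp f (ftens g (fid U))) y = perm_at f y /\
    label_at (fcomp f (ftens g (fid U))) y = label_at f y.
  move=> ge; rewrite perm_at_comp label_at_comp perm_at_tens label_at_tens_idr // ltnNge ge /= perm_at_id.
  rewrite subnKC //; split=> //.
  rewrite -[RHS](@ocomp_idr_ent (flist_cat A U)); congr ocomp.
  by rewrite !label_at_id entry_at_cat -eA ltnNge ge.
symmetry; apply: ftr_eq => /=.
  rewrite msetD0 ftr_loopsE msetDA; congr msetD; rewrite eA; apply: eq_cycs.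
  move=> j /andP[nj _]; apply/esym/(cyc_ext nj) => x nx _; apply: fb.
  by rewrite eA.
move=> i lt; rewrite perm_at_comp label_at_comp.
apply: (trail_pre (s := perm_at f) (l := label_at f) (i := perm_at g i)); last first.
- by rewrite eA; apply: ftr_trail; rewrite -eA perm_at_lt.
- exact: fb.
- by rewrite label_at_comp perm_at_tens label_at_tens lt.
- by rewrite perm_at_comp perm_at_tens lt.
Qed.

Lemma ftr_output U A B B' (f : fhom (flist_cat A U) (flist_cat B U))
    (g : fhom B B') :
  fcomp g (ftr f) = ftr (fcomp (ftens g (fid U)) f).
Proof.
have eA := ftr_arity f.
have s'E y : perm_at (fcomp (ftens g (fid U)) f) y =
    if perm_at f y < arity A then perm_at g (perm_at f y) else perm_at f y.
  rewrite perm_at_comp perm_at_tens perm_at_id -eA; case: ltnP => //; lia.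
have l'E y : label_at (fcomp (ftens g (fid U)) f) y =
    if perm_at f y < arity A then ocomp (label_at g (perm_at f y)) (label_at f y) else label_at f y.
  rewrite label_at_comp label_at_tens -eA; case: ltnP => // ge.
  rewrite -[RHS](@ocomp_idl_ent _ _ _ f _ erefl); congr ocomp.
  by rewrite !label_at_id entry_at_cat -eA ltnNge ge.
have gn y : (perm_at g y < arity A) = (y < arity A) by rewrite eA perm_at_lt.
symmetry; apply: ftr_eq => /=.
  rewrite msetD0 ftr_loopsE msetDAC; congr (_ `+` _ `+` _); apply: eq_cycs.
  move=> j /andP[nj _]; apply/esym/(cyc_ext nj) => x nx; rewrite s'E l'E.
  by case: ltnP => [|//] lt; move: (lt); rewrite -gn ltnNge => /negbTE->; case.
move=> i lt; rewrite perm_at_comp label_at_comp.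
apply: (@trail_post _ (perm_at f) (label_at f) _ _ _ (perm_at g) (label_at g)); last exact: ftr_trail.
- by move=> y ge; rewrite s'E l'E ltnNge ge.
- by move=> y; rewrite -ltnNge s'E l'E => lty; rewrite lty -ltnNge gn.
Qed.

Lemma ftr_vanish_unit A B
    (f : fhom (flist_cat A (flist_nil C)) (flist_cat B (flist_nil C))) :
  ftr f = @castm (FTr C) _ _ _ _ (flist_cat0r A) (flist_cat0r B) f.
Proof.
apply: ftr_eq => /=.
  by rewrite floops_castm /cycs big_geq ?msetD0 //= addn0.
move=> i lt; rewrite perm_at_castm label_at_castm; apply: trail1.
by rewrite -ltnNge; have := perm_at_lt f i; rewrite /= addn0 lt.
Qed.

Lemma ftr_vanish_tens U V A B
    (f : fhom (flist_cat A (flist_cat U V)) (flist_cat B (flist_cat U V))) :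
  ftr f = ftr (ftr (@castm (FTr C) _ _ _ _ (flist_catA A U V) (flist_catA B U V) f
    : fhom (flist_cat (flist_cat A U) V) (flist_cat (flist_cat B U) V))).
Proof.
set f' := @castm (FTr C) _ _ _ _ _ _ f.
have ret i : i < arity A + arity U ->
    trail (perm_at f) (label_at f) (leq (arity A + arity U)) i (perm_at (ftr f') i) (label_at (ftr f') i).
  by move=> lt; have := @ftr_trail _ V (flist_cat A U) (flist_cat B U) f' i lt;
    rewrite perm_at_castm label_at_castm.
apply: ftr_eq => /=.
  rewrite !ftr_loopsE floops_castm -msetDA; congr msetD.
  (* Cycles inside V come from the inner trace. All others have their least element in U, where the
     outer trace finds them through the first-return map. *)
  rewrite /cycs /= addnA (@big_cat_nat _ _ _ (arity A + arity U)) ?leq_addr //=.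
  rewrite msetDC; congr msetD; first by rewrite perm_at_castm label_at_castm.
  apply: eq_big_nat => j /andP[_ jlt]; apply: cyc_return ret _ jlt.
  exact: perm_at_periodic.
move=> i lt; apply: (trail_return ret).
- by move=> y; apply: leq_trans; rewrite leq_addr.
- exact: ltn_addr.
- exact: ftr_trail.
Qed.

Lemma ftr_superpose U A B W Z (f : fhom (flist_cat A U) (flist_cat B U))
    (g : fhom W Z) :
  ftens g (ftr f) =
  ftr (@castm (FTr C) _ _ _ _ (flist_catA W A U) (flist_catA Z B U) (ftens g f)
    : fhom (flist_cat (flist_cat W A) U) (flist_cat (flist_cat Z B) U)).
Proof.
have es x : perm_at (ftens g f) (arity W + x) = arity W + perm_at f x.
  by rewrite perm_at_tens ltnNge leq_addr addKn.
have el x : label_at (ftens g f) (arity W + x) = label_at f x.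
  by rewrite label_at_tens ltnNge leq_addr addKn.
symmetry; apply: ftr_eq; rewrite perm_at_castm label_at_castm.
  rewrite floops_castm /= ftr_loopsE -msetDA; congr (_ `+` (_ `+` _)).
  exact: cycs_shift.
move=> i /= lt; rewrite perm_at_tens label_at_tens; case: ltnP => ge.
  rewrite -[perm_at g i](_ : perm_at (ftens g f) i = _); last by rewrite perm_at_tens ge.
  rewrite -[label_at g i](_ : label_at (ftens g f) i = _); last by rewrite label_at_tens ge.
  apply: trail1; rewrite perm_at_tens ge -ltnNge ltn_addr // perm_at_lt //.
rewrite -{1}(subnKC ge); apply: trail_shift es el _ _ => [x|].
  by rewrite leq_add2l.
by apply: ftr_trail; lia.
Qed.

Lemma ftr_yank U : ftr (fsym U U) = fid U.
Proof.
have out j : arity U <= j -> j < arity U + arity U ->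
    trail (perm_at (fsym U U)) (label_at (fsym U U)) (ltn j) j (j - arity U) (label_at (fid U) (j - arity U)).
  move=> ge lt; have e : perm_at (fsym U U) j = j - arity U.
    by rewrite perm_at_sym ltnNge ge lt.
  have -> : label_at (fid U) (j - arity U) = label_at (fsym U U) j.
    by rewrite label_at_id label_at_sym entry_at_cat ltnNge ge.
  by rewrite -e; apply: trail1; rewrite e -leqNgt leq_subr.
apply: ftr_eq => /=.
  rewrite mset0D /cycs big_nat big1 // => j /andP[ge lt].
  apply: (cyc0 (out j ge lt)) => e; case: (posnP (arity U)) => U0; lia.
move=> i lt; have e : perm_at (fsym U U) i = arity U + i by rewrite perm_at_sym lt.
have eU : entry_at (flist_cat U U) i = Some (U (Ordinal lt)).
  by rewrite entry_at_cat lt -[i]/(val (Ordinal lt)) entry_at_ord.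
have e' : perm_at (fsym U U) (arity U + i) = i.
  by rewrite perm_at_sym ltnNge leq_addr /= ltn_add2l lt addKn.
have el : label_at (fsym U U) (arity U + i) = oid (U (Ordinal lt)).
  by rewrite label_at_sym entry_at_cat ltnNge leq_addr addKn -[i]/(val (Ordinal lt)) entry_at_ord.
have el' : label_at (fsym U U) i = oid (U (Ordinal lt)) by rewrite label_at_sym eU.
have -> : label_at (fid U) i = ocomp (label_at (fsym U U) (arity U + i)) (label_at (fsym U U) i).
  by rewrite el el' (ocomp_idl HC) // (@label_at_idE _ U _ (U (Ordinal lt))) // -[i]/(val (Ordinal lt)) entry_at_ord.
apply: trailS; rewrite e ?leq_addr // perm_at_id -{2}e'; apply: trail1.
by rewrite e' -ltnNge.
Qed.

Lemma ftr_dinat U U' A B (f : fhom (flist_cat A U) (flist_cat B U'))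
    (g : fhom U' U) :
  ftr (fcomp (ftens (fid B) g) f) = ftr (fcomp f (ftens (fid A) g)).
Proof.
have eU : arity U' = arity U := fhom_arity g.
have eA : arity A = arity B.
  by have := fhom_arity f; rewrite /= eU => /addIn.
set F1 := fcomp (ftens (fid B) g) f.
set F2 := fcomp f (ftens (fid A) g).
pose G := perm_at (ftens (fid A) g).
have GB x : perm_at (ftens (fid B) g) x = G x by rewrite /G !perm_at_tens !perm_at_id eA.
have G_ge x : (arity A <= G x) = (arity A <= x).
  by rewrite /G perm_at_tens perm_at_id; case: ltnP => [lt|_]; rewrite ?leq_addr // leqNgt lt.
have Glow x : G x < arity A -> G x = x.
  by rewrite ltnNge G_ge -ltnNge /G perm_at_tens perm_at_id => ->.
have s1E x : perm_at F1 x = G (perm_at f x) by rewrite perm_at_comp GB.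
have s2E x : perm_at F2 x = perm_at f (G x) by rewrite perm_at_comp.
have l1E x : label_at F1 x = ocomp (label_at (ftens (fid B) g) (perm_at f x)) (label_at f x).
  by rewrite label_at_comp.
have l2E x : label_at F2 x = ocomp (label_at f (G x)) (label_at (ftens (fid A) g) x).
  by rewrite label_at_comp.
have lGE x : arity A <= x -> label_at (ftens (fid B) g) x = label_at (ftens (fid A) g) x.
  by move=> ge; rewrite !label_at_tens -eA ltnNge ge.
symmetry; apply: ftr_eq => /=.
  rewrite !mset0D ftr_loopsE (msetDC (floops g)); congr msetD; symmetry.
  rewrite eU.
  apply: (cycs_conj s1E s2E l1E l2E lGE).
  - exact: perm_at_inj.
  - exact: perm_at_periodic.
  - exact: perm_at_inj.
  - exact: perm_at_periodic.
  - exact: perm_at_periodic.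
  - exact: G_ge.
  - by move=> x; rewrite -eU; apply: (perm_at_lt (ftens (fid A) g)).
  - exact: (perm_at_lt F1).
move=> i lt; have Gi : G i = i by rewrite /G perm_at_tens lt perm_at_id.
(* Gives the label the shape produced by [trail_conj]; the factor added is an identity because i
   lies in A. *)
have -> : label_at (ftr F1) i = ocomp (label_at (ftr F1) i) (label_at (ftens (fid A) g) i).
  by rewrite label_at_tens lt ocomp_idr_ent.
apply: (trail_conj s1E s2E l1E l2E lGE) Gi => // [x|x ltx|].
- exact: Glow.
- rewrite -[RHS](@ocomp_idl_ent _ _ _ f _ erefl) label_at_tens -eA ltx; congr ocomp.
  by rewrite !label_at_id entry_at_cat -eA ltx.
- exact: ftr_trail.
Qed.

Lemma FTr_trace : is_trace M.
Proof.
split.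
- exact: ftr_input.
- exact: ftr_output.
- exact: ftr_dinat.
(* [FTr_strict_monoidal] is opaque, so its object equations are identified with the [flist_cat]
   lemmas by proof irrelevance. *)
- move=> A B f; rewrite (Prop_irrelevance (tensIr M A) (flist_cat0r A)).
  by rewrite (Prop_irrelevance (tensIr M B) (flist_cat0r B)); apply: ftr_vanish_unit.
- move=> U V A B f; rewrite (Prop_irrelevance (tensA M A U V) (flist_catA A U V)).
  rewrite (Prop_irrelevance (tensA M B U V) (flist_catA B U V)).
  exact: ftr_vanish_tens.
- move=> U A B W Z f g; rewrite (Prop_irrelevance (tensA M W A U) (flist_catA W A U)).
  rewrite (Prop_irrelevance (tensA M Z B U) (flist_catA Z B U)).
  exact: ftr_superpose.
- exact: ftr_yank.
Qed.

Theorem FTr_traced : is_traced_ssmc (FTr C).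
Proof.
exact: (IsTracedSsmc (FTr_category C) (FTr_symmetric C) FTr_trace).
Qed.

End TraceAxioms.

(** * Untyped calculus in a traced category *)

Definition typed (C : cat_data) (f : option (arr C)) (A B : C) :=
  exists h : Hom A B, f = Some (Arr h).

Lemma typed_conv (C : cat_data) (f : option (arr C)) (A B A' B' : C) :
  typed f A B -> A = A' -> B = B' -> typed f A' B'.
Proof. by move=> t <- <-. Qed.

Lemma typed_Arr (C : cat_data) (A B : C) (h : Hom A B) : typed (Some (Arr h)) A B.
Proof. by exists h. Qed.

Lemma typed_comp (C : cat_data) (f g : option (arr C)) (A B B' D : C) :
  typed f A B -> typed g B' D -> B = B' -> typed (ocomp g f) A D.
Proof. by case=> h -> [h' ->] e; case: B' / e h' => h'; rewrite ocompE; apply: typed_Arr. Qed.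

Lemma typed_id (C : cat_data) (A : C) : typed (oid A) A A.
Proof. exact: typed_Arr. Qed.

Definition oten (D : tsmc_data) (f g : option (arr D)) : option (arr D) :=
  match f, g with
  | Some f, Some g => Some (Arr (mor f ⊗m mor g))
  | _, _ => None
  end.
Arguments oten {D} f g : simpl never.

Lemma otenE (D : tsmc_data) (A B A' B' : D) (f : Hom A B) (g : Hom A' B') :
  oten (Some (Arr f)) (Some (Arr g)) = Some (Arr (f ⊗m g)).
Proof. by []. Qed.

Definition osym (D : tsmc_data) (A B : D) := Some (Arr (sym A B)).

(** U, A and B are explicit because the endpoints of an arrow do not determine their tensor
    factors. *)
Definition otr (D : tsmc_data) (U A B : D) (f : option (arr D)) : option (arr D) :=
  match f with
  | Some f =>
      match pselect (adom f = A ⊗ U), pselect (acod f = B ⊗ U) with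
      | left e, left e' => Some (Arr (tr U (castm e e' (mor f))))
      | _, _ => None
      end
  | None => None
  end.

Arguments otr {D} U A B f : simpl never.

Lemma otrE (D : tsmc_data) (U A B : D) (f : Hom (A ⊗ U) (B ⊗ U)) :
  otr U A B (Some (Arr f)) = Some (Arr (tr U f)).
Proof.
rewrite /otr; case: pselect => // e; case: pselect => // e'.
by rewrite castm_id.
Qed.

Lemma otr_castm (D : tsmc_data) (X Y U A B : D) (f : Hom X Y)
    (e : X = A ⊗ U) (e' : Y = B ⊗ U) :
  otr U A B (Some (Arr f)) = Some (Arr (tr U (castm e e' f))).
Proof. by rewrite -otrE Arr_castm. Qed.

Lemma typed_ten (D : tsmc_data) (f g : option (arr D)) (A B A' B' : D) :
  typed f A B -> typed g A' B' -> typed (oten f g) (A ⊗ A') (B ⊗ B').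
Proof. by move=> [h ->] [h' ->]; apply: typed_Arr. Qed.

Lemma typed_sym (D : tsmc_data) (A B : D) : typed (osym A B) (A ⊗ B) (B ⊗ A).
Proof. exact: typed_Arr. Qed.

Lemma typed_tr (D : tsmc_data) (U A B X Y : D) f :
  typed f X Y -> X = A ⊗ U -> Y = B ⊗ U -> typed (otr U A B f) A B.
Proof. by move=> [h ->] e e'; rewrite (otr_castm _ e e'); apply: typed_Arr. Qed.

Section ArrowAlgebra.
Variable E : traced_ssmc.
Implicit Types (A B U V W X Y Z P Q x y : E) (f g h : option (arr E)).

Let H := traced_ssmc_axioms E.
Let HC := ssmc_category H.
Let M := ssmc_monoidal H.
Let HS : is_symmetric M := ssmc_symmetric H.
Let HT : is_trace M := ssmc_trace H.

Lemma tens_assoc A B U : A ⊗ (B ⊗ U) = (A ⊗ B) ⊗ U. Proof. exact: tensA M _ _ _. Qed.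
Lemma tens_unitl A : unit_ob ⊗ A = A. Proof. exact: tensIl M _. Qed.
Lemma tens_unitr A : A ⊗ unit_ob = A. Proof. exact: tensIr M _. Qed.

Lemma ocomp_assoc h g f : ocomp h (ocomp g f) = ocomp (ocomp h g) f.
Proof. exact: ocompA HC _ _ _. Qed.

Lemma ocomp_oidl B f : oacod f = Some B -> ocomp (oid B) f = f.
Proof. exact: ocomp_idl. Qed.

Lemma ocomp_oidr A f : oadom f = Some A -> ocomp f (oid A) = f.
Proof. exact: ocomp_idr. Qed.

Lemma oten_id A B : oten (oid A) (oid B) = oid (A ⊗ B).
Proof. by rewrite otenE (tensm_id M). Qed.

Lemma oten_comp f g f' g' : oacod f = oadom g -> oacod f' = oadom g' ->
  oten (ocomp g f) (ocomp g' f') = ocomp (oten g g') (oten f f').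
Proof.
case: f g => [[A B f]|] [[B2 D g]|] //= e.
case: e => e.
case: B2 / e g => g.
case: f' g' => [[A' B' f']|] [[B2' D' g']|] //= e; last by rewrite ocompE.
case: e => e.
case: B2' / e g' => g'.
by rewrite !(ocompE, otenE) (tensm_comp M).
Qed.

Lemma otenA f g h : oten f (oten g h) = oten (oten f g) h.
Proof.
case: f => [[A B f]|] //; case: g => [[A' B' g]|] //; case: h => [[A'' B'' h]|] //.
by rewrite !otenE -(tensmA M) Arr_castm.
Qed.

Lemma oten1l f : oten (oid unit_ob) f = f.
Proof.
by case: f => [[A B f]|] //; rewrite otenE -[in RHS](tensmIl M f) Arr_castm.
Qed.

Lemma oten1r f : oten f (oid unit_ob) = f.
Proof.
by case: f => [[A B f]|] //; rewrite otenE -[in RHS](tensmIr M f) Arr_castm.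
Qed.

Lemma osym_nat A A' B B' f g : typed f A A' -> typed g B B' ->
  ocomp (osym A' B') (oten f g) = ocomp (oten g f) (osym A B).
Proof. by move=> [a ->] [b ->]; rewrite /osym !(ocompE, otenE) (sym_nat HS). Qed.

Lemma osymK A B : ocomp (osym B A) (osym A B) = oid (A ⊗ B).
Proof. by rewrite /osym ocompE (symK HS). Qed.

Lemma osym_unitr A : osym A unit_ob = oid A.
Proof. by rewrite /osym /oid -(sym_unit HS) Arr_castm. Qed.

Lemma osym_unitl A : osym unit_ob A = oid A.
Proof.
have := osymK A unit_ob; rewrite osym_unitr tens_unitr => <-.
by rewrite ocomp_oidr //= tens_unitl.
Qed.

Lemma osym_hex A B D :
  osym A (B ⊗ D) = ocomp (oten (oid B) (osym A D)) (oten (osym A B) (oid D)).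
Proof.
rewrite /osym -(Arr_castm (tensA M A B D) (esym (tensA M B D A))) (sym_hexagon HS).
by rewrite -ocompE Arr_castm.
Qed.

Lemma otr_in U A A' B f g : typed f (A ⊗ U) (B ⊗ U) -> typed g A' A ->
  ocomp (otr U A B f) g = otr U A' B (ocomp f (oten g (oid U))).
Proof. by move=> [a ->] [b ->]; rewrite !(ocompE, otrE, otenE) (tr_input HT). Qed.

Lemma otr_out U A B B' f g : typed f (A ⊗ U) (B ⊗ U) -> typed g B B' ->
  ocomp g (otr U A B f) = otr U A B' (ocomp (oten g (oid U)) f).
Proof. by move=> [a ->] [b ->]; rewrite !(ocompE, otrE, otenE) (tr_output HT). Qed.

Lemma otr_dinat U V A B f g : typed f (A ⊗ U) (B ⊗ V) -> typed g V U ->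
  otr U A B (ocomp (oten (oid B) g) f) = otr V A B (ocomp f (oten (oid A) g)).
Proof. by move=> [a ->] [b ->]; rewrite !(ocompE, otrE, otenE) (tr_dinat HT). Qed.

Lemma otr_unit A B f : typed f A B -> otr unit_ob A B f = f.
Proof.
move=> [a ->]; rewrite (otr_castm _ (esym (tens_unitr A)) (esym (tens_unitr B))).
by rewrite (tr_vanish_unit HT) !Arr_castm.
Qed.

Lemma otr_tens U V A B f : typed f (A ⊗ (U ⊗ V)) (B ⊗ (U ⊗ V)) ->
  otr (U ⊗ V) A B f = otr U A B (otr V (A ⊗ U) (B ⊗ U) f).
Proof.
move=> [a ->]; rewrite otrE (tr_vanish_tens HT) -otrE -otrE.
by rewrite Arr_castm.
Qed.

Lemma otr_super U A B W Z f g : typed f (A ⊗ U) (B ⊗ U) -> typed g W Z ->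
  oten g (otr U A B f) = otr U (W ⊗ A) (Z ⊗ B) (oten g f).
Proof.
move=> [a ->] [b ->]; rewrite otrE !otenE (tr_superpose HT) -otrE.
by rewrite Arr_castm.
Qed.

Lemma otr_yank U : otr U U U (osym U U) = oid U.
Proof. by rewrite otrE (tr_yank HT). Qed.

End ArrowAlgebra.

Ltac solve_objects := by rewrite ?tens_assoc ?tens_unitl ?tens_unitr ?tens_assoc.

(** Endpoints are synthesized from the shape of the term and compared afterwards by [solve_objects],
    modulo associativity and units. *)
Ltac infer_type :=
  lazymatch goal with
  | |- typed (ocomp _ _) _ _ => eapply typed_comp; [infer_type | infer_type | solve_objects]
  | |- typed (oten _ _) _ _ => eapply typed_ten; infer_type
  | |- typed (oid _) _ _ => apply typed_id
  | |- typed (osym _ _) _ _ => apply typed_sym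
  | |- typed (otr _ _ _ _) _ _ => eapply typed_tr; [infer_type | solve_objects | solve_objects]
  | H : typed ?f _ _ |- typed ?f _ _ => exact H
  end.

Ltac solve_typed := eapply typed_conv; [infer_type | solve_objects | solve_objects].

Lemma typed_dom (C : cat_data) (f : option (arr C)) (A B A' : C) :
  typed f A B -> A = A' -> oadom f = Some A'.
Proof. by case=> h -> /= ->. Qed.

Lemma typed_cod (C : cat_data) (f : option (arr C)) (A B B' : C) :
  typed f A B -> B = B' -> oacod f = Some B'.
Proof. by case=> h -> /= ->. Qed.

Lemma typed_match (C : cat_data) (f g : option (arr C)) (A B B' D : C) :
  typed f A B -> typed g B' D -> B = B' -> oacod f = oadom g.
Proof. by case=> h -> [h' ->] /= ->. Qed.

Ltac solve_typing :=
  lazymatch goal with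
  | |- oacod _ = Some _ => eapply typed_cod; [infer_type | solve_objects]
  | |- oadom _ = Some _ => eapply typed_dom; [infer_type | solve_objects]
  | |- oacod _ = oadom _ => eapply typed_match; [infer_type | infer_type | solve_objects]
  | |- typed _ _ _ => solve_typed
  end.

(** * Insertion of one wire in a traced category *)

Section Insertion.
Variable E : traced_ssmc.
Implicit Types (A B U V W X Y Z P Q x y : E) (f g h a b l : option (arr E)).

(** The second hexagon is the first one inverted: the right-hand side is a right inverse of
    [osym D (A ⊗ B)], as is the left-hand side. *)
Lemma osym_hexl A B D :
  osym (A ⊗ B) D = ocomp (oten (osym A D) (oid B)) (oten (oid A) (osym B D)).
Proof.
set r := RHS.
have e : ocomp (osym D (A ⊗ B)) r = oid (A ⊗ B ⊗ D).
  rewrite /r osym_hex -ocomp_assoc (ocomp_assoc (oten (osym D A) _)) -oten_comp; try solve_typing.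
  rewrite osymK ocomp_oidl; last solve_typing.
  rewrite oten_id (ocomp_oidl (B := A ⊗ D ⊗ B)); last solve_typing.
  rewrite -oten_comp; try solve_typing.
  by rewrite osymK ocomp_oidl // oten_id tens_assoc.
rewrite -[LHS](@ocomp_oidr _ (A ⊗ B ⊗ D)) // -e ocomp_assoc osymK ocomp_oidl // /r; solve_typing.
Qed.

Lemma oten_idl_comp W f g : oacod f = oadom g ->
  oten (oid W) (ocomp g f) = ocomp (oten (oid W) g) (oten (oid W) f).
Proof. by move=> e; rewrite -oten_comp // ocomp_oidl. Qed.

Lemma oten_idr_comp W f g : oacod f = oadom g ->
  oten (ocomp g f) (oid W) = ocomp (oten g (oid W)) (oten f (oid W)).
Proof. by move=> e; rewrite -oten_comp // ocomp_oidl. Qed.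

(* a with one more wire l, whose output is inserted between P and Q. *)
Definition ins P Q y a l := ocomp (oten (oid P) (osym Q y)) (oten a l).

Lemma typed_ins P Q x y X a l : typed a X (P ⊗ Q) -> typed l x y ->
  typed (ins P Q y a l) (X ⊗ x) (P ⊗ (y ⊗ Q)).
Proof. by move=> ta tl; rewrite /ins; solve_typing. Qed.

Lemma ins_tens P Q x y X X' Y a b l :
  typed a X Y -> typed b X' (P ⊗ Q) -> typed l x y ->
  oten a (ins P Q y b l) = ins (Y ⊗ P) Q y (oten a b) l.
Proof.
move=> ta tb tl; rewrite /ins -oten_id -!otenA.
rewrite -(oten_comp (f := a) (g := oid Y)); try solve_typing.
by rewrite ocomp_oidl //; solve_typing.
Qed.

Lemma ins0 X Y x y a l : typed a X Y -> typed l x y -> ins Y unit_ob y a l = oten a l.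
Proof. by move=> ta tl; rewrite /ins osym_unitl oten_id ocomp_oidl //; solve_typing. Qed.

Lemma ins_comp P Q y a b l k : oacod b = oadom a -> oacod k = oadom l ->
  ins P Q y (ocomp a b) (ocomp l k) = ocomp (ins P Q y a l) (oten b k).
Proof. by move=> e e'; rewrite /ins oten_comp // ocomp_assoc. Qed.

Lemma ins_move P Q U V x y z a l : typed a (U ⊗ (y ⊗ V)) (P ⊗ Q) -> typed l x z ->
  ocomp (ins P Q z (ocomp a (oten (oid U) (osym V y))) l)
    (oten (oid (U ⊗ V)) (osym x y)) =
  ocomp (ins P Q z a l) (oten (oid U) (osym (V ⊗ x) y)).
Proof.
move=> ta tl; rewrite -{1}(ocomp_oidr (A := x) (f := l)); last solve_typing.
rewrite ins_comp; try solve_typing; rewrite -ocomp_assoc; congr ocomp.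
by rewrite osym_hexl oten_idl_comp ?otenA ?oten_id //; solve_typing.
Qed.

Lemma ins_sym U V x : ins V U x (osym U V) (oid x) = osym U (V ⊗ x).
Proof. by rewrite /ins osym_hex. Qed.

(** Naturality ([nat]) moves the symmetry of the inputs past the labels k and l. What remains,
    [core], involves symmetries only: z crosses v twice, and the crossings cancel. *)
Lemma ins_swap P Q W X u v y z a l k :
  typed a X (P ⊗ (Q ⊗ W)) -> typed l u v -> typed k y z ->
  ins (P ⊗ (z ⊗ Q)) W v (ins P (Q ⊗ W) z a k) l =
  ocomp (ins P (Q ⊗ (v ⊗ W)) z (ins (P ⊗ Q) W v a l) k)
        (oten (oid X) (osym y u)).
Proof.
move=> ta tl tk; rewrite /ins.
have core :
    ocomp (osym (Q ⊗ (v ⊗ W)) z)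
      (ocomp (oten (oten (oid Q) (osym W v)) (oid z))
         (oten (oid (Q ⊗ W)) (osym z v))) =
    ocomp (oten (oid (z ⊗ Q)) (osym W v)) (oten (osym (Q ⊗ W) z) (oid v)).
  rewrite ocomp_assoc (@osym_nat _ (Q ⊗ (W ⊗ v)) _ z z); try solve_typing.
  rewrite tens_assoc osym_hexl -!ocomp_assoc -oten_comp; try solve_typing.
  rewrite ocomp_oidl // osymK oten_id ocomp_oidr; last solve_typing.
  by rewrite otenA oten_id.
have nat : ocomp (oten (oten a l) k) (oten (oid X) (osym y u)) =
    ocomp (oten (oid (P ⊗ (Q ⊗ W))) (osym z v)) (oten (oten a k) l).
  rewrite -!otenA -!oten_comp; try solve_typing.
  by rewrite (osym_nat tk tl) ocomp_oidl ?ocomp_oidr; try solve_typing.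
rewrite -[in RHS](ocomp_oidl (B := z) (f := k)); last solve_typing.
rewrite oten_comp; try solve_typing.
rewrite -!ocomp_assoc nat.
rewrite -[in LHS](ocomp_oidl (B := v) (f := l)); last solve_typing.
rewrite oten_comp; try solve_typing.
rewrite !ocomp_assoc; congr ocomp.
rewrite -(oten_id P Q) -otenA -(oten_id P (Q ⊗ W)) -!otenA -!oten_idl_comp; try solve_typing.
rewrite [oten (oid Q) _]otenA -ocomp_assoc core oten_idl_comp; try solve_typing.
by rewrite [oten (oid P) (oten (oid (z ⊗ Q)) _)]otenA oten_id.
Qed.

(* The traced wire leaves through l and comes back as the last output of a; it is
   straightened by yanking. *)
Lemma otr_ins P Q A x y a l : typed a A (P ⊗ (Q ⊗ x)) -> typed l x y ->
  otr x A (P ⊗ (y ⊗ Q)) (ins P (Q ⊗ x) y a l) =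
  ocomp (oten (oid P) (osym Q y)) (ocomp (oten (oid (P ⊗ Q)) l) a).
Proof.
move=> ta tl.
(* Isolates [osym x x] between two arrows that are the identity on the traced wire; output
   naturality, input naturality and superposing then reduce the trace to yanking. *)
have -> : ins P (Q ⊗ x) y a l =
    ocomp (oten (ocomp (oten (oid P) (osym Q y)) (oten (oid (P ⊗ Q)) l)) (oid x))
      (ocomp (oten (oid (P ⊗ Q)) (osym x x)) (oten a (oid x))).
  rewrite /ins osym_hexl oten_idl_comp; try solve_typing.
  rewrite oten_idr_comp; try solve_typing.
  rewrite -!ocomp_assoc otenA; congr ocomp; rewrite ocomp_assoc -!otenA -oten_idl_comp; try solve_typing.
  rewrite -(osym_nat (typed_id x) tl) oten_idl_comp; try solve_typing.
  rewrite -ocomp_assoc otenA oten_id; congr ocomp.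
  rewrite [oten (oid (P ⊗ Q)) _]otenA oten_id -oten_comp; try solve_typing.
  by rewrite ocomp_oidl ?ocomp_oidr //; solve_typing.
rewrite -(otr_out (B := P ⊗ Q ⊗ x)); try solve_typing.
rewrite -(otr_in (A := P ⊗ Q ⊗ x)); try solve_typing.
rewrite -(@otr_super _ x x x _ _ _ (oid (P ⊗ Q))); try solve_typing.
rewrite otr_yank oten_id ocomp_oidl ?ocomp_assoc //; solve_typing.
Qed.

(** The symmetry with the unit is an identity, so its naturality turns into commutation. *)
Lemma scalar_comm (s f : option (arr E)) A B : typed s unit_ob unit_ob -> typed f A B -> oten s f = oten f s.
Proof.
move=> ts tf; have := osym_nat ts tf; rewrite !osym_unitl ocomp_oidl ?ocomp_oidr //; solve_typing.
Qed.

Lemma scalar_comp (s t : option (arr E)) : typed s unit_ob unit_ob -> typed t unit_ob unit_ob ->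
  ocomp s t = oten s t.
Proof.
move=> ts tt; rewrite -[s in LHS]oten1r -[t in LHS]oten1l -oten_comp; try solve_typing.
by rewrite ocomp_oidl ?ocomp_oidr //; solve_typing.
Qed.

(** Dinaturality at the unit object; it makes the value of a loop independent of the representative
    of its class. *)
Lemma otr_cyc A B f g : typed f A B -> typed g B A ->
  otr A unit_ob unit_ob (ocomp g f) = otr B unit_ob unit_ob (ocomp f g).
Proof.
by move=> tf tg; rewrite -{1}(oten1l g) -{2}(oten1l g) (otr_dinat (V := B)) //; solve_typing.
Qed.

End Insertion.

(** * Normal forms interpreted in two traced categories at once *)

Section Interpretation.
Variables (C : category) (E : traced_ssmc) (F : functor_data C E).
Hypothesis HF : is_functor F.
Implicit Types (s t : seq C).

Let HC := category_axioms C.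

(** Objects are described by lists rather than by [flist], since normal forms are built by induction
    on the last input. *)
Definition Obs s : E := foldr (fun x A => F x ⊗ A) unit_ob s.

Lemma Obs_cons x s : Obs (x :: s) = F x ⊗ Obs s. Proof. by []. Qed.

Lemma Obs_cat s t : Obs (s ++ t) = Obs s ⊗ Obs t.
Proof. by elim: s => [|x s IHs] /=; rewrite ?tens_unitl // IHs tens_assoc. Qed.

Lemma Obs1 x : Obs [:: x] = F x. Proof. exact: tens_unitr. Qed.

Lemma Obs_rcons s x : Obs (rcons s x) = Obs s ⊗ F x.
Proof. by rewrite -cats1 Obs_cat Obs1. Qed.

Definition wire x y (l : Hom x y) : option (arr E) := Some (Arr (fmap F l)).

Arguments wire : simpl never.

Lemma typed_wire x y (l : Hom x y) : typed (wire l) (F x) (F y).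
Proof. exact: typed_Arr. Qed.

Lemma wire_comp x y z (l : Hom x y) (k : Hom y z) :
  wire (k ∘ l) = ocomp (wire k) (wire l).
Proof. by rewrite /wire ocompE (fmap_comp HF). Qed.

Lemma wire_id x : wire (idm x) = oid (F x).
Proof. by rewrite /wire (fmap_id HF). Qed.

Definition loop_val (c : loops C) : option (arr E) :=
  let e := repr c : endo C in
  otr (F (tag e)) unit_ob unit_ob (wire (tagged e)).

Lemma typed_loop_val c : typed (loop_val c) unit_ob unit_ob.
Proof. by eapply typed_tr; [apply: typed_wire|rewrite tens_unitl..]. Qed.

Lemma loop_valE x (l : Hom x x) :
  loop_val (loop_class l) = otr (F x) unit_ob unit_ob (wire l).
Proof.
have main (e e' : endo C) : clos_refl_sym_trans _ (@cyclic_perm C) e e' ->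
    otr (F (tag e)) unit_ob unit_ob (wire (tagged e)) =
    otr (F (tag e')) unit_ob unit_ob (wire (tagged e')).
  elim=> {e e'} [e e' [A B p q]|//|e e' _ ->//|e e' e'' _ -> _ //].
  rewrite /Endo /= !(chain_catE HC) !wire_comp.
  by apply: otr_cyc; apply: typed_wire.
apply: (main _ (Endo l)).
have : \pi_(loops C)%qT (repr (loop_class l)) = \pi_(loops C)%qT (Endo l : {classic endo C}).
  by rewrite reprK.
by move/eqmodP/asboolP.
Qed.

Definition scal (s : seq (loops C)) : option (arr E) :=
  foldr (fun c a => oten (loop_val c) a) (oid unit_ob) s.

Lemma typed_scal (s : seq (loops C)) : typed (scal s) unit_ob unit_ob.
Proof.
elim: s => [|c s IHs] /=; first exact: typed_id.
by have tc := typed_loop_val c; eapply typed_conv; [infer_type|rewrite tens_unitl..].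
Qed.

Lemma scal_cat (s t : seq (loops C)) : scal (s ++ t) = oten (scal s) (scal t).
Proof. by elim: s => [|c s IHs] /=; rewrite ?oten1l // IHs otenA. Qed.

(** Scalars commute, so the order in which a multiset of loops is enumerated does not matter. *)
Lemma scal_perm (s t : seq (loops C)) : perm_eq s t -> scal s = scal t.
Proof.
elim: s t => [|c s IHs] t st; first by rewrite perm_sym in st; rewrite (perm_nilP st).
have ct : c \in t by rewrite -(perm_mem st) mem_head.
case/splitPr: ct st => p q; rewrite -[c :: q]cat1s perm_sym perm_catCA /= perm_cons.
rewrite perm_sym => /IHs e; rewrite /= e !scal_cat /= !otenA; congr oten.
exact: scalar_comm (typed_loop_val c) (typed_scal p).
Qed.

End Interpretation.

Lemma cat_cases (T : Type) (s1 s2 t1 t2 : seq T) : s1 ++ s2 = t1 ++ t2 ->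
  (exists m, t1 = s1 ++ m /\ s2 = m ++ t2) \/
  (exists m, s1 = t1 ++ m /\ t2 = m ++ s2).
Proof.
elim: s1 t1 => [|x s1 IHs] [|y t1] /= e.
- by left; exists [::].
- by left; exists (y :: t1).
- by right; exists (x :: s1).
- case: e => -> /IHs[[m [-> ->]]|[m [-> ->]]]; by [left; exists m|right; exists m].
Qed.

(** * Pairs of interpretations and their closure under the operations *)

Section Simulation.
Variables (C : category) (E1 E2 : traced_ssmc).
Variables (F1 : functor_data C E1) (F2 : functor_data C E2).
Hypotheses (HF1 : is_functor F1) (HF2 : is_functor F2).
Implicit Types (X Y Z P Q : seq C) (a : option (arr E1)) (b : option (arr E2)).

Local Notation O1 := (Obs F1).
Local Notation O2 := (Obs F2).

(* a and b are the interpretations in E1 and E2 of one formal labelled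
   permutation, built by adding the inputs one after the other. *)
Inductive sim : seq C -> seq C -> option (arr E1) -> option (arr E2) -> Prop :=
| sim_nil : sim [::] [::] (oid unit_ob) (oid unit_ob)
| sim_ins X P Q a b x y (l : Hom x y) : sim X (P ++ Q) a b ->
    sim (rcons X x) (P ++ y :: Q)
      (ins (O1 P) (O1 Q) (F1 y) a (wire F1 l))
      (ins (O2 P) (O2 Q) (F2 y) b (wire F2 l)).

Lemma sim_ty X Y a b : sim X Y a b -> typed a (O1 X) (O1 Y) /\ typed b (O2 X) (O2 Y).
Proof.
elim=> {X Y a b} [|X P Q a b x y l _ [ta tb]].
  by split; apply: typed_id.
rewrite !Obs_cat in ta tb *; rewrite !Obs_rcons.
by split; apply: typed_ins => //; apply: typed_wire.
Qed.

Lemma sim_ins' X P Q Y Z a b a' b' x y (l : Hom x y) : sim X Y a b ->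
  Y = P ++ Q -> Z = P ++ y :: Q ->
  a' = ins (O1 P) (O1 Q) (F1 y) a (wire F1 l) ->
  b' = ins (O2 P) (O2 Q) (F2 y) b (wire F2 l) ->
  sim (rcons X x) Z a' b'.
Proof. by move=> s e -> -> ->; apply: sim_ins; rewrite -e. Qed.

Lemma sim_inv X x Z a b : sim (rcons X x) Z a b ->
  exists P Q y (l : Hom x y) a0 b0, [/\ Z = P ++ y :: Q, sim X (P ++ Q) a0 b0,
    a = ins (O1 P) (O1 Q) (F1 y) a0 (wire F1 l)
  & b = ins (O2 P) (O2 Q) (F2 y) b0 (wire F2 l)].
Proof.
move eX: (rcons X x) => X' s; case: s eX => [|X0 P Q a0 b0 x0 y l s].
  by case: X.
by move=> /rcons_inj[eX ex]; subst; exists P, Q, y, l, a0, b0.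
Qed.

Lemma sim_inv0 Z a b : sim [::] Z a b ->
  [/\ Z = [::], a = oid unit_ob & b = oid unit_ob].
Proof.
by move eX: [::] => X s; case: s eX => [//|[|? ?]].
Qed.

Lemma sim_id X : sim X X (oid (O1 X)) (oid (O2 X)).
Proof.
elim/last_ind: X => [|X x IHX]; first exact: sim_nil.
apply: (@sim_ins' X X [::] X _ _ _ _ _ x x (idm x) IHX); rewrite ?cats0 ?cats1 //.
  by rewrite (ins0 (typed_id _) (typed_wire _ _)) wire_id // oten_id Obs_rcons.
by rewrite (ins0 (typed_id _) (typed_wire _ _)) wire_id // oten_id Obs_rcons.
Qed.

Lemma sim_tens X Y X' Y' a b a' b' : sim X Y a b -> sim X' Y' a' b' ->
  sim (X ++ X') (Y ++ Y') (oten a a') (oten b b').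
Proof.
move=> s s'; have [ta tb] := sim_ty s.
elim: s' => {X' Y' a' b'} [|X' P Q a' b' x y l s' IH].
  by rewrite !oten1r !cats0.
have [ta' tb'] := sim_ty s'; rewrite Obs_cat in ta'; rewrite Obs_cat in tb'.
have tl1 := typed_wire F1 l; have tl2 := typed_wire F2 l.
rewrite -rcons_cat; apply: (sim_ins' (P := Y ++ P) (l := l) IH); rewrite ?catA //.
  by rewrite Obs_cat (ins_tens ta ta' tl1).
by rewrite Obs_cat (ins_tens tb tb' tl2).
Qed.

Lemma sim_wire x y (l : Hom x y) : sim [:: x] [:: y] (wire F1 l) (wire F2 l).
Proof.
apply: (sim_ins' (P := [::]) (Q := [::]) (l := l) sim_nil) => //.
  by rewrite (ins0 (typed_id _) (typed_wire _ _)) oten1l.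
by rewrite (ins0 (typed_id _) (typed_wire _ _)) oten1l.
Qed.

(* The coherence step: the order in which the last two wires are inserted is
   irrelevant. *)
Lemma sim_swap X u y Z a b : sim (rcons (rcons X u) y) Z a b ->
  sim (rcons (rcons X y) u) Z
    (ocomp a (oten (oid (O1 X)) (osym (F1 y) (F1 u))))
    (ocomp b (oten (oid (O2 X)) (osym (F2 y) (F2 u)))).
Proof.
case/sim_inv=> P2 [Q2 [y' [k [a1 [b1 [-> s1 -> ->]]]]]].
have tk1 := typed_wire F1 k; have tk2 := typed_wire F2 k.
case/sim_inv: s1 => P1 [Q1 [u' [l [a2 [b2 [e s2 -> ->]]]]]].
have tl1 := typed_wire F1 l; have tl2 := typed_wire F2 l.
(* The output u' of the earlier wire lies to the right of y' in the first case and to its left in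
   the second. *)
have {e} [[m [eP eQ]]|[m [eP eQ]]] : 
    (exists m, P1 = P2 ++ m /\ Q2 = m ++ u' :: Q1) \/
    (exists m, P2 = P1 ++ u' :: m /\ Q1 = m ++ Q2).
  case: (cat_cases e) => [|[[|u'' m] /= [eP eQ]]]; first by left.
    by left; exists [::]; rewrite eP !cats0 -eQ.
  by case: eQ eP => <- -> ->; right; exists m.
- subst; have [ta tb] := sim_ty s2.
  rewrite !Obs_cat -?tens_assoc in ta; rewrite !Obs_cat -?tens_assoc in tb.
  apply: (@sim_ins' _ (P2 ++ y' :: m) Q1 _ _ _ _ _ _ _ _ l).
  + by apply: (@sim_ins _ P2 (m ++ Q1) _ _ _ _ k); rewrite catA; exact: s2.
  + by rewrite -!catA.
  + by rewrite -!catA.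
  + by rewrite !(Obs_cat, Obs_cons) (ins_swap ta tl1 tk1).
  + by rewrite !(Obs_cat, Obs_cons) (ins_swap tb tl2 tk2).
- subst; have [ta tb] := sim_ty s2.
  rewrite !Obs_cat -?tens_assoc in ta; rewrite !Obs_cat -?tens_assoc in tb.
  apply: (@sim_ins' _ P1 (m ++ y' :: Q2) _ _ _ _ _ _ _ _ l).
  + by apply: (@sim_ins _ (P1 ++ m) Q2 _ _ _ _ k); rewrite -catA; exact: s2.
  + by rewrite -!catA.
  + by rewrite -!catA.
  (* Here [ins_swap] is used with the two wires exchanged, which leaves two opposite symmetries to
     cancel. *)
  + rewrite !(Obs_cat, Obs_cons) (ins_swap ta tk1 tl1) -ocomp_assoc -oten_idl_comp; try solve_typing.
    rewrite osymK oten_id ocomp_oidr //; apply: typed_dom; last by rewrite tens_assoc.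
    by apply: typed_ins tl1; apply: typed_conv (typed_ins _ tk1) _ _; [solve_typing|solve_objects|solve_objects].
  + rewrite !(Obs_cat, Obs_cons) (ins_swap tb tk2 tl2) -ocomp_assoc -oten_idl_comp; try solve_typing.
    rewrite osymK oten_id ocomp_oidr //; apply: typed_dom; last by rewrite tens_assoc.
    by apply: typed_ins tl2; apply: typed_conv (typed_ins _ tk2) _ _; [solve_typing|solve_objects|solve_objects].
Qed.

(** Inversion exposes only the last input; iterated swaps bring an arbitrary input y there. *)
Lemma sim_move Y1 y Y2 Z a b : sim (Y1 ++ y :: Y2) Z a b ->
  sim (rcons (Y1 ++ Y2) y) Z
    (ocomp a (oten (oid (O1 Y1)) (osym (O1 Y2) (F1 y))))
    (ocomp b (oten (oid (O2 Y1)) (osym (O2 Y2) (F2 y)))).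
Proof.
elim/last_ind: Y2 Z a b => [|Y2 u IH] Z a b s.
  have [ta tb] := sim_ty s; rewrite !Obs_cat !Obs1 in ta tb.
  by rewrite cats0 -cats1 !osym_unitl !oten_id !ocomp_oidr //; solve_typing.
rewrite -rcons_cons -rcons_cat in s.
have [P [Q [z [l [a0 [b0 [-> s0 -> ->]]]]]]] := sim_inv s.
have [ta tb] := sim_ty s0.
rewrite !(Obs_cat, Obs_cons) in ta; rewrite !(Obs_cat, Obs_cons) in tb.
have := sim_swap (sim_ins l (IH _ _ _ s0)).
rewrite !Obs_cat !Obs_rcons rcons_cat.
by rewrite (ins_move ta (typed_wire _ _)) (ins_move tb (typed_wire _ _)).
Qed.

(** The last wire of the first normal form ends at some y in the middle of the intermediate list.
    After [sim_move] y is the last input of the second one, so the two labels compose and the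
    induction continues on the remaining wires. *)
Lemma sim_comp X Y Z a b a' b' : sim X Y a b -> sim Y Z a' b' ->
  sim X Z (ocomp a' a) (ocomp b' b).
Proof.
move=> s; elim: s Z a' b' => {X Y a b} [|X Y1 Y2 a b x y l s IH] Z a' b' s'.
  by have [-> -> ->] := sim_inv0 s'; rewrite !ocomp_oidl //; apply: sim_nil.
have [P [Q [z [k [a1 [b1 [-> s1 ea eb]]]]]]] := sim_inv (sim_move s').
have [ta1 tb1] := sim_ty s1; have [ta tb] := sim_ty s.
have tl1 := typed_wire F1 l; have tk1 := typed_wire F1 k.
have tl2 := typed_wire F2 l; have tk2 := typed_wire F2 k.
apply: (sim_ins' (l := k ∘ l) (IH _ _ _ s1)) => //.
  by rewrite {1}/ins ocomp_assoc ea (wire_comp HF1) ins_comp //; solve_typing.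
by rewrite {1}/ins ocomp_assoc eb (wire_comp HF2) ins_comp //; solve_typing.
Qed.

Lemma sim_sym X Y : sim (X ++ Y) (Y ++ X) (osym (O1 X) (O1 Y)) (osym (O2 X) (O2 Y)).
Proof.
elim/last_ind: Y => [|Y y IHY].
  by rewrite cats0 !osym_unitr; apply: sim_id.
rewrite -rcons_cat; apply: (sim_ins' (l := idm y) IHY) => //.
- by rewrite cat_rcons.
- by rewrite wire_id // ins_sym Obs_rcons.
- by rewrite wire_id // ins_sym Obs_rcons.
Qed.

Definition scaled_sim X Y a b := exists s a0 b0,
  [/\ sim X Y a0 b0, a = oten (scal F1 s) a0 & b = oten (scal F2 s) b0].

Lemma sim_scaled X Y a b : sim X Y a b -> scaled_sim X Y a b.
Proof. by move=> s; exists [::], a, b; rewrite !oten1l. Qed.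

Lemma scaled_sim_ty X Y a b : scaled_sim X Y a b ->
  typed a (O1 X) (O1 Y) /\ typed b (O2 X) (O2 Y).
Proof.
case=> s [a0 [b0 [/sim_ty[ta tb] -> ->]]].
have t1 := typed_scal F1 s; have t2 := typed_scal F2 s.
by split; solve_typing.
Qed.

Lemma scaled_sim_comp X Y Z a b a' b' : scaled_sim X Y a b ->
  scaled_sim Y Z a' b' -> scaled_sim X Z (ocomp a' a) (ocomp b' b).
Proof.
case=> s [a0 [b0 [r -> ->]]] [s' [a0' [b0' [r' -> ->]]]].
have [ta tb] := sim_ty r; have [ta' tb'] := sim_ty r'.
have t1 := typed_scal F1 s; have t2 := typed_scal F2 s.
have t1' := typed_scal F1 s'; have t2' := typed_scal F2 s'.
exists (s' ++ s), (ocomp a0' a0), (ocomp b0' b0); split; first exact: sim_comp r r'.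
  by rewrite scal_cat -(scalar_comp t1' t1) oten_comp //; solve_typing.
by rewrite scal_cat -(scalar_comp t2' t2) oten_comp //; solve_typing.
Qed.

Lemma scaled_sim_tens X Y X' Y' a b a' b' : scaled_sim X Y a b ->
  scaled_sim X' Y' a' b' ->
  scaled_sim (X ++ X') (Y ++ Y') (oten a a') (oten b b').
Proof.
case=> s [a0 [b0 [r -> ->]]] [s' [a0' [b0' [r' -> ->]]]].
have [ta tb] := sim_ty r; have [ta' tb'] := sim_ty r'.
exists (s ++ s'), (oten a0 a0'), (oten b0 b0'); split; first exact: sim_tens.
  rewrite !scal_cat !otenA; congr oten; rewrite -!otenA; congr oten.
  by rewrite (scalar_comm (typed_scal _ _) ta).
rewrite !scal_cat !otenA; congr oten; rewrite -!otenA; congr oten.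
by rewrite (scalar_comm (typed_scal _ _) tb).
Qed.

(** With Q empty the last wire runs from x back to x: superposing splits its trace off as a scalar.
    Otherwise the traced output belongs to another wire, and [otr_ins] rewrites the trace without
    any feedback. *)
Lemma sim_tr1 X Y x a b : sim (rcons X x) (rcons Y x) a b ->
  scaled_sim X Y (otr (F1 x) (O1 X) (O1 Y) a) (otr (F2 x) (O2 X) (O2 Y) b).
Proof.
case/sim_inv=> P [Q [y [l [a0 [b0 []]]]]].
have tl1 := typed_wire F1 l; have tl2 := typed_wire F2 l.
elim/last_ind: Q => [|Q x' _] e s -> ->.
  rewrite cats1 in e; case/rcons_inj: e => eP ey; subst.
  rewrite cats0 in s; have [ta tb] := sim_ty s.
  exists [:: loop_class l], a0, b0; split=> //.
    rewrite /= oten1r (ins0 ta tl1) loop_valE // (scalar_comm (typed_tr tl1 _ _) ta); try solve_objects.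
    by rewrite (otr_super (W := O1 X) (Z := O1 P)) ?tens_unitr //; solve_typing.
  rewrite /= oten1r (ins0 tb tl2) loop_valE // (scalar_comm (typed_tr tl2 _ _) tb); try solve_objects.
  by rewrite (otr_super (W := O2 X) (Z := O2 P)) ?tens_unitr //; solve_typing.
rewrite -rcons_cons -rcons_cat in e; case/rcons_inj: e => eY ex; subst x' Y.
have [ta tb] := sim_ty s; apply: sim_scaled.
rewrite !(Obs_cat, Obs_cons, Obs_rcons) in ta tb *.
rewrite (otr_ins ta tl1) (otr_ins tb tl2).
apply: (@sim_comp _ ((P ++ Q) ++ [:: y])).
  apply: sim_comp s _; rewrite -cats1 catA -!Obs_cat.
  exact: sim_tens (sim_id _) (sim_wire l).
rewrite -[y :: Q]cat1s -catA; apply: sim_tens; first exact: sim_id.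
by have := sim_sym Q [:: y]; rewrite !Obs1.
Qed.

Lemma scaled_sim_tr X Y U a b : scaled_sim (X ++ U) (Y ++ U) a b ->
  scaled_sim X Y (otr (O1 U) (O1 X) (O1 Y) a) (otr (O2 U) (O2 X) (O2 Y) b).
Proof.
elim/last_ind: U a b => [|U x IHU] a b r.
  rewrite !cats0 in r; have [ta tb] := scaled_sim_ty r.
  by rewrite !otr_unit.
have [ta tb] := scaled_sim_ty r.
rewrite !(Obs_cat, Obs_rcons) in ta tb *.
rewrite !otr_tens //; apply: IHU.
rewrite -!rcons_cat in r; case: r => s [a0 [b0 [r ea eb]]]; subst a b.
have [s' [a1 [b1 [r1 e1 e2]]]] := sim_tr1 r.
have [ta0 tb0] := sim_ty r; rewrite !Obs_rcons in ta0 tb0.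
exists (s ++ s'), a1, b1; split=> //.
  rewrite scal_cat -otenA -e1 (otr_super _ (typed_scal _ _)) //.
  by rewrite !tens_unitl !Obs_cat.
rewrite scal_cat -otenA -e2 (otr_super _ (typed_scal _ _)) //.
by rewrite !tens_unitl !Obs_cat.
Qed.

End Simulation.

Lemma typed_uniq (C : cat_data) (a : option (arr C)) (A B A' B' : C) :
  typed a A B -> typed a A' B' -> A = A' /\ B = B'.
Proof. by case=> h -> [h'] /Some_inj /arr_eq[eA [eB _]]. Qed.

(** * The free traced category is generated by normal forms *)

Section FreeTraced.
Variable C : category.
Implicit Types (s t : seq C) (X Y P Q : flist C).

Let HC := category_axioms C.

Definition free_traced : traced_ssmc := TracedSsmc (FTr_traced C).
Local Notation FT := free_traced.
Definition iotaF : functor_data C FT := iota C.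

Lemma perm_at_iota (x y : C) (l : Hom x y) i : perm_at (fmap (iota C) l : fhom _ _) i = i.
Proof. by rewrite /perm_at; case: insubP => //= j _. Qed.

Lemma label_at_iota (x y : C) (l : Hom x y) i :
  label_at (fmap (iota C) l : fhom _ _) i = if i == 0 then Some (Arr l) else None.
Proof. by case: i => [|i]; [exact: (@label_at_ord C (flist1 x) (flist1 y) _ ord0) | exact: label_at_out]. Qed.

Lemma iota_functor : is_functor (iota C).
Proof.
split=> [x|x y z f g]; apply: arr_inj; apply: fhom_eq => //=.
by rewrite mset0D.
Qed.

Local Notation O1 := (Obs iotaF).

Lemma arity_Obs s : arity (O1 s : flist C) = size s.
Proof. by elim: s => //= x s <-. Qed.

Lemma entry_at_Obs s i : entry_at (O1 s : flist C) i = onth s i.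
Proof.
elim: s i => [|x s IHs] i; first by rewrite entry_at_out ?onth0n.
rewrite [O1 _]/= entry_at_cat /=; case: i => [|i] /=.
  exact: (entry_at_ord (X := flist1 x) ord0).
by rewrite subn1 IHs.
Qed.

Lemma Obs_inj s t : O1 s = O1 t -> s = t.
Proof.
move=> e; apply: eq_from_onth => i.
by rewrite -!entry_at_Obs e.
Qed.

Definition seq_of X : seq C := [seq X i | i <- enum 'I_(arity X)].

Lemma Obs_seq_of X : O1 (seq_of X) = X.
Proof.
apply: (@flist_eq C); first by rewrite arity_Obs size_map size_enum_ord.
move=> i; rewrite entry_at_Obs onth_map /entry_at; congr omap.
have [lt|ge] := ltnP i (arity X).
  rewrite onthE (nth_map (Ordinal lt)) ?size_enum_ord //.
  rewrite -[i]/(val (Ordinal lt)) valK; congr Some; apply: val_inj.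
  by rewrite /= nth_enum_ord.
by rewrite onth_default ?size_enum_ord // insubF // ltnNge ge.
Qed.

Lemma seq_of_Obs s : seq_of (O1 s) = s.
Proof. by apply: Obs_inj; rewrite Obs_seq_of. Qed.

Definition operm_at (a : option (arr (FTr C))) i :=
  if a is Some a then perm_at (mor a : fhom _ _) i else i.
Definition olabel_at (a : option (arr (FTr C))) i :=
  if a is Some a then label_at (mor a : fhom _ _) i else None.
Definition ofloops (a : option (arr (FTr C))) : {mset loops C} :=
  if a is Some a then floops (mor a : fhom _ _) else mset0.

Lemma view_eq (a b : option (arr (FTr C))) X Y : typed a X Y -> typed b X Y ->
  ofloops a = ofloops b -> (forall i, i < arity X -> operm_at a i = operm_at b i) ->
  (forall i, i < arity X -> olabel_at a i = olabel_at b i) -> a = b.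
Proof.
case=> f -> [g ->] /= eS ep el; congr Some; apply: fhom_eq => // i.
  have [/ep//|ge] := ltnP i (arity X); by rewrite !perm_at_out.
have [/el//|ge] := ltnP i (arity X); by rewrite !label_at_out.
Qed.

Section InsertionViews.
Variables (X P Q : flist C) (x y : C) (l : Hom x y) (a : option (arr (FTr C))).
Hypothesis ta : typed a X (flist_cat P Q).

Local Notation b := (@ins FT P Q (flist1 y) a (wire iotaF l)).

(** The last wire and the remaining wires can be recovered from an insertion: [bump] opens a gap at
    the output of the new wire. Totality and functionality of [sim] both rest on this. *)
Lemma ins_view : ofloops b = ofloops a /\ forall i,
  (operm_at b i = if i < arity X then bump (arity P) (operm_at a i)
             else if i == arity X then arity P else i) /\
  (olabel_at b i = if i < arity X then olabel_at a i
             else if i == arity X then Some (Arr l) else None).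
Proof.
case: ta => f ->.
have e := esym (flist_catA P Q (flist1 y)).
have eX : arity X = arity P + arity Q := fhom_arity f.
(* The middle objects of the composite agree only up to associativity; the cast in [f'] makes it a
   typed [fcomp]. *)
pose f' : fhom (flist_cat X (flist1 x)) (flist_cat P (flist_cat Q (flist1 y))) :=
  @castm (FTr C) _ _ _ _ erefl e (ftens f (fmap (iota C) l)).
pose g : fhom (flist_cat P (flist_cat Q (flist1 y))) _ :=
  ftens (fid P) (fsym Q (flist1 y)).
have -> : @ins FT P Q (flist1 y) (Some (@Arr (FTr C) _ _ f)) (wire iotaF l) =
    Some (@Arr (FTr C) _ _ (fcomp g f')).
  rewrite /ins /oid /osym /wire !otenE.
  exact: (@ocomp_typed (FTr C) _ _ _ _ _ _ e).
split; first by rewrite /= floops_castm /= !mset0D !msetD0.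
have lg j : label_at g j = label_at (fid (flist_cat P (flist_cat Q (flist1 y)))) j.
  rewrite label_at_tens !label_at_id !label_at_sym !entry_at_cat; case: ltnP => //.
move=> i; split.
  rewrite [LHS](perm_at_comp g f') perm_at_castm !perm_at_tens perm_at_id perm_at_sym /= perm_at_iota /bump.
  have := perm_at_lt f i; case: (ltnP i) => lt lt'.
    case_ifs; lia.
  case: eqP => [->|ne].
    rewrite eX subnn addn0; case_ifs; lia.
  case_ifs; lia.
rewrite [LHS](label_at_comp g f') lg (ocomp_idl_ent f') // label_at_castm label_at_tens label_at_iota.
case: (ltnP i) => // ge; congr (if _ then _ else _); lia.
Qed.

End InsertionViews.

(** Tracing the only wire of [iota] leaves no inputs and one cycle of length one, so exactly the
    loop c is created. *)
Lemma loop_val_iota c : exists2 g : fhom (flist_nil C) (flist_nil C),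
  loop_val iotaF c = Some (@Arr (FTr C) _ _ g) & floops g = [mset c].
Proof.
rewrite /loop_val; case ec: (repr c : endo C) => [A l] /=.
have e : flist1 A = flist_cat (flist_nil C) (flist1 A) by rewrite flist_cat0l.
exists (ftr (@castm (FTr C) _ _ _ _ e e (fmap (iota C) l))).
  exact: (@otr_castm (FTr C) _ _ _ _ _ _ e e).
rewrite /= ftr_loopsE floops_castm /= mset0D perm_at_castm label_at_castm /cycs big_nat1.
rewrite (@cycT _ _ _ _ (Some (Arr l))).
  rewrite oloopE; congr [mset _]; rewrite -[RHS]reprK /loop_class.
  congr (\pi_ _)%qT; exact: esym.
have := @trail1 _ (perm_at (fmap (iota C) l : fhom _ _)) (label_at (fmap (iota C) l : fhom _ _)) (ltn 0) 0.
by rewrite perm_at_iota label_at_iota; apply.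
Qed.

Lemma scal_iota (s' : seq (loops C)) : exists2 g : fhom (flist_nil C) (flist_nil C),
  scal iotaF s' = Some (@Arr (FTr C) _ _ g) & floops g = seq_mset s'.
Proof.
elim: s' => [|c s' [g eg fg]]; first by exists (fid _); rewrite //= -(seq_mset_id mset0) enum_mset0.
have [h eh fh] := loop_val_iota c.
have e := flist_cat0l (flist_nil C).
exists (@castm (FTr C) _ _ _ _ e e (ftens h g)).
  by rewrite /= eg eh Arr_castm.
by rewrite floops_castm /= fh fg mset_cons.
Qed.

Lemma ofloops_scal (s' : seq (loops C)) (f0 : option (arr (FTr C))) X Y : typed f0 X Y ->
  ofloops (@oten FT (scal iotaF s') f0) = seq_mset s' `+` ofloops f0.
Proof. by case=> f ->; have [g -> <-] := scal_iota s'. Qed.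

Lemma operm_at_scal (s' : seq (loops C)) (f0 : option (arr (FTr C))) X Y i : typed f0 X Y ->
  operm_at (@oten FT (scal iotaF s') f0) i = operm_at f0 i.
Proof.
by case=> f ->; have [g -> _] := scal_iota s'; rewrite otenE [LHS]perm_at_tens /= subn0.
Qed.

Lemma olabel_at_scal (s' : seq (loops C)) (f0 : option (arr (FTr C))) X Y i : typed f0 X Y ->
  olabel_at (@oten FT (scal iotaF s') f0) i = olabel_at f0 i.
Proof.
by case=> f ->; have [g -> _] := scal_iota s'; rewrite otenE [LHS]label_at_tens /= subn0.
Qed.

Lemma mk_fhom X Y (p : nat -> nat) (l : nat -> option (arr C)) :
  arity X = arity Y ->
  (forall i, i < arity X -> p i < arity Y) ->
  (forall i j, i < arity X -> j < arity X -> p i = p j -> i = j) ->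
  (forall i, i < arity X -> oadom (l i) = entry_at X i /\ oacod (l i) = entry_at Y (p i)) ->
  exists2 f : fhom X Y, floops f = mset0 &
    forall i, i < arity X -> perm_at f i = p i /\ label_at f i = l i.
Proof.
move=> e p_lt p_inj tl.
pose q (i : 'I_(arity X)) : 'I_(arity Y) := Ordinal (p_lt i (ltn_ord i)).
have q_bij : bijective q.
  apply: inj_card_bij; last by rewrite !card_ord e.
  by move=> i j /(congr1 val) /= /p_inj eij; apply: val_inj; apply: eij.
have ex i : exists h : Hom (X i) (Y (q i)), l i = Some (Arr h).
  have [] := tl i (ltn_ord i); rewrite entry_at_ord (entry_at_ord (q i)).
  case: (l i) => [[A B h]|] //= [eA] [eB].
  by case: _ / eA; case: _ / eB; exists h.
exists (@FHom _ X Y e mset0 q q_bij (fun i => projT1 (cid (ex i)))) => // i lt.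
rewrite -[i]/(val (Ordinal lt)) perm_at_ord label_at_ord /=; split=> //.
by case: cid => h /= ->.
Qed.

(** * Totality and functionality of the simulation *)

Section Simulated.
Variables (D : traced_ssmc) (F : functor_data C D).
Hypothesis HF : is_functor F.
Implicit Types (a : option (arr (FTr C))) (b : option (arr D)) (S T : seq C).

(** Induction on the inputs: the last input n and its image k are removed, and [unbump k] closes the
    gap left among the outputs. *)
Lemma sim_total S T (f : fhom (O1 S : flist C) (O1 T)) : floops f = mset0 ->
  exists b, @sim C FT D iotaF F S T (Some (@Arr (FTr C) _ _ f)) b.
Proof.
elim/last_ind: S T f => [|S x IHS] T f f0.
  have T0 : T = [::].
    by apply: size0nil; rewrite -arity_Obs -(fhom_arity f) arity_Obs.
  subst T; exists (oid unit_ob).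
  have -> : @Arr (FTr C) _ _ f = Arr (idm (flist_nil C : FTr C)).
    by apply: fhom_eq => // i; [rewrite perm_at_id perm_at_out|rewrite label_at_id label_at_out // entry_at_nil].
  exact: sim_nil.
pose n := size S; pose k := perm_at f n.
have nS : arity (O1 (rcons S x) : flist C) = n.+1 by rewrite arity_Obs size_rcons.
have nT : size T = n.+1 by rewrite -arity_Obs -(fhom_arity f).
have kT : k < size T by rewrite nT -nS perm_at_lt nS.
have f_lt i : i < n.+1 -> perm_at f i < n.+1 by move=> lt; rewrite -nS perm_at_lt nS.
have f_k i : i < n -> perm_at f i <> k by move=> lt /perm_at_inj e; rewrite e ltnn in lt.
have f_inj := @perm_at_inj _ _ _ f.
have := label_at_dom f n; have := label_at_cod f n; rewrite !entry_at_Obs -/k.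
have -> : onth (rcons S x) n = Some x by rewrite -cats1 onth_cat ltnn subnn.
case el: (label_at f n) => [[x' y l]|] //= ey [ex]; subst x'.
have eT : T = take k T ++ y :: drop k.+1 T.
  by have := drop_nth y kT; rewrite (@onth_nth _ y _ _ _ (esym ey)) => <-; rewrite cat_take_drop.
set P := take k T in eT; set Q := drop k.+1 T in eT.
have sP : size P = k by rewrite size_takel // ltnW.
have sQ : size Q = n - k by rewrite size_drop nT subSS.
have [f' f'0 f'E] : exists2 f' : fhom (O1 S : flist C) (O1 (P ++ Q)),
    floops f' = mset0 & forall i, i < arity (O1 S : flist C) ->
    perm_at f' i = unbump k (perm_at f i) /\ label_at f' i = label_at f i.
  apply: mk_fhom => [|i|i j|i]; rewrite ?arity_Obs -/n.
  - by rewrite size_cat sP sQ; move: kT; rewrite nT; lia.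
  - move=> lt; have := f_k i lt; have := f_lt i (ltnW lt).
    rewrite size_cat sP sQ /unbump; move: kT; rewrite nT; lia.
  - move=> lti ltj e; apply: f_inj; have := f_k i lti; have := f_k j ltj.
    move: e; rewrite /unbump; lia.
  move=> lt; rewrite label_at_dom label_at_cod !entry_at_Obs; split.
    by rewrite -cats1 onth_cat lt.
  rewrite {1}eT !onth_cat sP /unbump; have := f_k i lt.
  case: (ltnP (perm_at f i) k) => [lt' _|ge ne].
    have -> : (k < perm_at f i) = false by lia.
    by rewrite subn0 lt'.
  have gt : k < perm_at f i by lia.
  rewrite gt subn1 ltnNge (_ : k <= (perm_at f i).-1) /=; last lia.
  have -> : perm_at f i - k = ((perm_at f i).-1 - k).+1 by lia.
  by [].
have [b s] := IHS _ f' f'0.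
have tf' : typed (Some (@Arr (FTr C) _ _ f')) (O1 S : flist C) (flist_cat (O1 P) (O1 Q)).
  by rewrite -[flist_cat _ _](@Obs_cat _ FT); apply: typed_Arr.
exists (ins (Obs F P) (Obs F Q) (F y) b (wire F l)).
apply: (sim_ins' (P := P) (Q := Q) (l := l) s) => //.
have [ve vE] := ins_view l tf'.
apply: (@view_eq _ _ (O1 (rcons S x)) (O1 T)); first exact: typed_Arr.
- apply: typed_conv (@typed_ins FT _ _ _ _ _ _ _ tf' (typed_wire iotaF l)) _ _.
    by rewrite Obs_rcons.
  by rewrite [in RHS]eT Obs_cat Obs_cons.
- by rewrite ve /= f'0.
- move=> i; rewrite nS ltnS => le; have [-> _] := vE i; rewrite !arity_Obs -/n sP.
  case: ltnP => lt.
    have [|/= -> _] := f'E i; first by rewrite arity_Obs.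
    have := f_k i lt; rewrite /bump /unbump; lia.
  by rewrite (_ : i = n) ?eqxx //; lia.
- move=> i; rewrite nS ltnS => le; have [_ ->] := vE i; rewrite !arity_Obs -/n.
  case: ltnP => lt.
    by have [|/= _ ->] := f'E i; first by rewrite arity_Obs.
  by rewrite (_ : i = n) ?eqxx //=; lia.
Qed.

Lemma sim_loopfree S T a b : @sim C FT D iotaF F S T a b -> ofloops a = mset0.
Proof.
elim=> {S T a b} [//|S P Q a b x y l s IH].
have [ta _] := sim_ty s; rewrite Obs_cat in ta.
by have [-> _] := ins_view l ta.
Qed.

Lemma sim_functional S T T' a b b' :
  @sim C FT D iotaF F S T a b -> @sim C FT D iotaF F S T' a b' -> b = b'.
Proof.
move=> s; elim: s T' b' => {S T a b} [|S P Q a b x y l s IH] T' b' s'.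
  by case: (sim_inv0 s').
have [tb _] := sim_ty (sim_ins l s).
have [tb' _] := sim_ty s'; have [_ eT] := typed_uniq tb tb'.
have [P' [Q' [y' [l' [a' [b0' [eT' s0' ea ->]]]]]]] := sim_inv s'.
rewrite eT' in eT; move/Obs_inj: eT => eT.
have [ta _] := sim_ty s; rewrite Obs_cat in ta.
have [ta' _] := sim_ty s0'; rewrite Obs_cat in ta'.
have [ve vE] := ins_view l ta; have [ve' vE'] := ins_view l' ta'.
(* At the index of the last input the views return the place of insertion and the label, which
   identifies P, Q, y and l on both sides. *)
have [pn ln] := vE (arity (O1 S : flist C)).
have [pn' ln'] := vE' (arity (O1 S : flist C)).
rewrite ea ltnn eqxx pn' ltnn eqxx !arity_Obs in pn.
rewrite ea ltnn eqxx ln' ltnn eqxx in ln.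
have eP : P = P'.
  by have := congr1 (take (size P)) eT; rewrite take_size_cat // -pn take_size_cat.
have [ey eQ] : y = y' /\ Q = Q'.
  have := congr1 (drop (size P)) eT; rewrite drop_size_cat // -pn drop_size_cat //.
  by case.
subst P' y' Q'; move: ln => /Some_inj /arr_inj el; subst l'.
have eaa : a = a'.
  apply: (view_eq ta ta'); first by rewrite -ve -ve' ea.
    move=> i lt; have [p _] := vE i; have [p' _] := vE' i.
    by rewrite ea p' lt in p; apply: (can_inj (bumpK _) (esym p)).
  move=> i lt; have [_ p] := vE i; have [_ p'] := vE' i.
  by rewrite ea p' lt in p.
by subst a'; rewrite (IH _ _ s0').
Qed.

Lemma scaled_sim_total X Y (f : fhom X Y) :
  exists h : Hom (Obs F (seq_of X)) (Obs F (seq_of Y)),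
  @scaled_sim C FT D iotaF F (seq_of X) (seq_of Y)
    (Some (@Arr (FTr C) _ _ f)) (Some (Arr h)).
Proof.
suff [b s] : exists b, @scaled_sim C FT D iotaF F (seq_of X) (seq_of Y)
    (Some (@Arr (FTr C) _ _ f)) b.
  by have [_ [h eb]] := scaled_sim_ty s; exists h; rewrite -eb.
have [S eS] : exists S, X = O1 S by exists (seq_of X); rewrite Obs_seq_of.
have [T eT] : exists T, Y = O1 T by exists (seq_of Y); rewrite Obs_seq_of.
subst X Y; rewrite !seq_of_Obs.
pose f0 := FHom (fhom_arity f) mset0 (fperm_bij f) (flabel f).
have [b s] := @sim_total S T f0 erefl.
exists (oten (scal F (floops f)) b), (floops f), (Some (@Arr (FTr C) _ _ f0)), b.
split=> //.
have t0 : typed (Some (@Arr (FTr C) _ _ f0)) (O1 S : flist C) (O1 T) by exact: typed_Arr.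
apply: (@view_eq _ _ (O1 S) (O1 T)); first exact: typed_Arr.
- apply: typed_conv (typed_ten (typed_scal iotaF (floops f)) t0) _ _; exact: (@tens_unitl FT).
- by rewrite (ofloops_scal _ t0) seq_mset_id msetD0.
- by move=> i _; rewrite (operm_at_scal _ _ t0).
- by move=> i _; rewrite (olabel_at_scal _ _ t0).
Qed.

(** Normal forms carry no loops in the free category, so the multiset of the scalar factors is
    visible in a. *)
Lemma scaled_sim_functional S T a b b' :
  @scaled_sim C FT D iotaF F S T a b -> @scaled_sim C FT D iotaF F S T a b' -> b = b'.
Proof.
case=> s [a0 [b0 [r -> ->]]] [s' [a0' [b0' [r' e ->]]]].
have [ta _] := sim_ty r; have [ta' _] := sim_ty r'.
have es : seq_mset s = seq_mset s'.
  have := congr1 ofloops e; rewrite (ofloops_scal _ ta) (ofloops_scal _ ta').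
  by rewrite (sim_loopfree r) (sim_loopfree r') !msetD0.
have ea : a0 = a0'.
  apply: (view_eq ta ta'); first by rewrite (sim_loopfree r) (sim_loopfree r').
    by move=> i _; have := congr1 (operm_at^~ i) e; rewrite (operm_at_scal _ _ ta) (operm_at_scal _ _ ta').
  by move=> i _; have := congr1 (olabel_at^~ i) e; rewrite (olabel_at_scal _ _ ta) (olabel_at_scal _ _ ta').
subst a0'; rewrite (sim_functional r r'); congr oten.
by apply: scal_perm => //; apply/eq_seq_msetP.
Qed.

End Simulated.

End FreeTraced.

Lemma functor_eq (C D : cat_data) (G G' : functor_data C D) :
  (forall A, G A = G' A) ->
  (forall (A B : C) (f : Hom A B), Arr (fmap G f) = Arr (fmap G' f)) -> G = G'.
Proof.
case: G G' => [o m] [o' m'] /= /funext eo; case: o' / eo m' => m' em.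
congr FunctorData; apply: functional_extensionality_dep => A.
apply: functional_extensionality_dep => B; apply: funext => f.
exact/arr_inj/em.
Qed.

(** * The universal property *)

Section Extension.
Variables (C : category) (D : traced_ssmc) (F : functor_data C D).
Hypothesis HF : is_functor F.
Implicit Types (X Y U : flist C).

Local Notation FT := (free_traced C).
Local Notation O1 := (Obs (iotaF C)).
Local Notation O2 := (Obs F).

Let Hi : is_functor (iotaF C) := iota_functor C.

Definition extension : functor_data (FTr C) D :=
  @FunctorData (FTr C) D (fun X => O2 (seq_of X))
    (fun X Y f => projT1 (cid (scaled_sim_total F f))).

Local Notation G := extension.

Lemma extension_sim X Y (f : @Hom (FTr C) X Y) :
  @scaled_sim C FT D (iotaF C) F (seq_of X) (seq_of Y)
    (Some (Arr f)) (Some (Arr (fmap G f))).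
Proof. by rewrite /extension /=; case: cid. Qed.

(** Reduces each preservation property to producing a related pair, which the closure lemmas for
    [scaled_sim] provide. *)
Lemma extensionE X Y (f : @Hom (FTr C) X Y) b :
  @scaled_sim C FT D (iotaF C) F (seq_of X) (seq_of Y) (Some (Arr f)) b ->
  Some (Arr (fmap G f)) = b.
Proof. exact: scaled_sim_functional (extension_sim f). Qed.

Lemma seq_of_cat X Y : seq_of (flist_cat X Y) = seq_of X ++ seq_of Y.
Proof. by apply: Obs_inj; rewrite Obs_cat !Obs_seq_of. Qed.

Lemma seq_of_nil : seq_of (flist_nil C) = [::].
Proof. by apply: Obs_inj; rewrite Obs_seq_of. Qed.

Lemma seq_of1 (x : C) : seq_of (flist1 x) = [:: x].
Proof. by apply: Obs_inj; rewrite Obs_seq_of Obs1. Qed.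

Lemma extension_functor : is_functor G.
Proof.
split=> [X|X Y Z f g]; apply/arr_inj/Some_inj.
  apply: extensionE; have := sim_scaled (sim_id Hi HF (seq_of X)).
  by rewrite Obs_seq_of.
rewrite -ocompE; apply: extensionE.
have := scaled_sim_comp Hi HF (extension_sim f) (extension_sim g).
by rewrite (@ocompE FT).
Qed.

Lemma extension_tens X Y : G (flist_cat X Y) = G X ⊗ G Y.
Proof. by rewrite /= seq_of_cat Obs_cat. Qed.

Lemma extension_traced : is_traced_ssm_functor G.
Proof.
apply: (@IsTracedSsmFunctor _ _ _ extension_functor extension_tens).
- by rewrite /= seq_of_nil.
- move=> X X' Y Y' f g; apply/arr_inj/Some_inj; rewrite Arr_castm -otenE.
  apply: extensionE; rewrite /= !seq_of_cat.
  exact: scaled_sim_tens (extension_sim f) (extension_sim g).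
- move=> X Y; apply/arr_inj/Some_inj; rewrite Arr_castm -/(osym _ _).
  apply: extensionE; rewrite /= !seq_of_cat.
  have := sim_scaled (sim_sym Hi HF (seq_of X) (seq_of Y)).
  by rewrite !Obs_seq_of.
- move=> U X Y f; apply/arr_inj/Some_inj; rewrite -otr_castm.
  apply: extensionE; move: (Some (Arr (fmap G f))) (extension_sim f) => b.
  rewrite !seq_of_cat => s; have := scaled_sim_tr Hi HF s.
  by rewrite !Obs_seq_of (@otrE FT).
Qed.

Lemma extension_iota : functor_comp G (iota C) = F.
Proof.
apply: functor_eq => [x|x y l]; first by rewrite /= seq_of1 Obs1.
apply: Some_inj; apply: (@extensionE (flist1 x) (flist1 y)).
rewrite !seq_of1; exact/sim_scaled/sim_wire.
Qed.

End Extension.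

(** * Uniqueness of the extension *)

Section Uniqueness.
Variables (C : category) (D : traced_ssmc) (G : functor_data (FTr C) D).
Hypothesis HG : is_traced_ssm_functor G.

Let HGf := tfun_functor HG.
Let HD := traced_ssmc_axioms D.

Local Notation FT := (free_traced C).
Local Notation F := (functor_comp G (iota C)).
Local Notation O1 := (Obs (iotaF C)).
Local Notation O2 := (Obs F).

Definition omap_arr (a : option (arr (FTr C))) : option (arr D) :=
  omap (fun a => Arr (fmap G (mor a))) a.

Local Notation "'G^'" := omap_arr.

Lemma omap_comp a b (X Y Z : FT) : typed b X Y -> typed a Y Z ->
  G^ (ocomp a b) = ocomp (G^ a) (G^ b).
Proof. by case=> f -> [g ->]; rewrite ocompE /= ocompE (fmap_comp HGf). Qed.

Lemma omap_ten a b : G^ (@oten FT a b) = oten (G^ a) (G^ b).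
Proof.
case: a b => [[X Y f]|] [[X' Y' g]|] //.
by rewrite !otenE -(tfun_tensm HG) Arr_castm.
Qed.

Lemma omap_id X : G^ (oid X) = oid (G X).
Proof. by rewrite /= (fmap_id HGf). Qed.

Lemma omap_sym (X Y : FT) : G^ (osym X Y) = osym (G X) (G Y).
Proof. by rewrite /osym -(tfun_sym HG) Arr_castm. Qed.

Lemma omap_tr (U X Y Z W : FT) a : typed a Z W -> Z = X ⊗ U -> W = Y ⊗ U ->
  G^ (@otr FT U X Y a) = otr (G U) (G X) (G Y) (G^ a).
Proof.
move=> ta eZ eW; subst; case: ta => f ->.
rewrite otrE /= (tfun_tr HG) -otrE Arr_castm //.
Qed.

Lemma omap_Obs s : G (O1 s) = O2 s.
Proof.
elim: s => [|x s IHs]; first exact: (tfun_unit HG).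
by rewrite /= -IHs; apply: (tfun_tens HG).
Qed.

(** A structure-preserving G sends each normal form to its interpretation along [G ∘ iota], as both
    are built by the same operations. Every morphism being a scaled normal form, G is determined by
    that composite. *)
Lemma omap_sim s t a b : @sim C FT D (iotaF C) F s t a b -> G^ a = b.
Proof.
elim=> {s t a b} [|s P Q a b x y l r <-].
  by rewrite omap_id; congr oid; apply: (tfun_unit HG).
have [ta _] := sim_ty r; rewrite Obs_cat in ta.
have tl := typed_wire (iotaF C) l.
rewrite /ins (omap_comp (X := O1 s ⊗ iotaF C x) (Y := O1 P ⊗ (O1 Q ⊗ iotaF C y))
  (Z := O1 P ⊗ (iotaF C y ⊗ O1 Q))); last exact: typed_ten (typed_id _) (typed_sym _ _).
  by rewrite !omap_ten omap_sym omap_id !omap_Obs.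
by apply: typed_conv (typed_ten ta tl) _ _ => //; rewrite tens_assoc.
Qed.

Lemma omap_scal s : G^ (@scal C FT (iotaF C) s) = scal F s.
Proof.
elim: s => [|c s IHs]; first by rewrite omap_id; congr oid; apply: (tfun_unit HG).
rewrite /= omap_ten IHs; congr oten; rewrite /loop_val.
rewrite (omap_tr (typed_wire (iotaF C) _)) ?tens_unitl //.
by congr otr; apply: (tfun_unit HG).
Qed.

Lemma omap_scaled_sim s t a b : @scaled_sim C FT D (iotaF C) F s t a b -> G^ a = b.
Proof.
by case=> s' [a0 [b0 [/omap_sim <- -> ->]]]; rewrite omap_ten omap_scal.
Qed.

Lemma extension_unique : extension F = G.
Proof.
apply: functor_eq => [X|X Y f].
  by rewrite /= -omap_Obs Obs_seq_of.
by apply: Some_inj; rewrite -(omap_scaled_sim (extension_sim F f)).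
Qed.

End Uniqueness.

Theorem mainTheorem1 (C : category) :
  is_traced_ssmc (FTr C) /\
  is_functor (iota C) /\
  forall (D : traced_ssmc) (F : functor_data C D), is_functor F ->
    exists! G : functor_data (FTr C) D,
      is_traced_ssm_functor G /\ functor_comp G (iota C) = F.
Proof.
split; first exact: FTr_traced.
split; first exact: iota_functor.
move=> D F HF; exists (extension F); split.
  by split; [exact: extension_traced|exact: extension_iota].
by move=> G [HG eF]; subst F; apply: extension_unique.
Qed.
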